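(* Let $\mathcal{A}$ be a Banach algebra which is isomorphic (as a Banach algebra) to a closed subalgebra of $\mathcal{B}(E)$ for some super-reflexive Banach space $E$. Then $\mathcal{A}$ is super Arens regular.
   Context: For a Banach space $E$ and an ultrafilter $\mathcal{U}$ on a set $I$, the ultrapower is $(E)_{\mathcal{U}} = \ell^\infty(E,I)/\{(x_i)_{i\in I} : \lim_{i\to\mathcal{U}}\|x_i\|=0\}$, with norm $\|(x_i)\|=\lim_{i\to\mathcal{U}}\|x_i\|$. If $\mathcal{A}$ is a Banach algebra, $(\mathcal{A})_{\mathcal{U}}$ is a Banach algebra under the pointwise product. A Banach space $E$ is super-reflexive if $(E)_{\mathcal{U}}$ is reflexive for every ultrafilter $\mathcal{U}$. $\mathcal{B}(E)$ is the Banach algebra of bounded linear operators on $E$. A Banach algebra is Arens regular if its first and second Arens products on the bidual coincide. $\mathcal{A}$ is super Arens regular if $(\mathcal{A})_{\mathcal{U}}$ is Arens regular for every ultrafilter $\mathcal{U}$. *)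

(* Defs.v *)
From HB Require Import structures.
From mathcomp Require Import all_boot all_order all_algebra.
From mathcomp Require Import complex.
From mathcomp Require Import all_classical reals topology normedtype.
Set Implicit Arguments.
Unset Strict Implicit.
Unset Printing Implicit Defensive.
Import Order.TTheory GRing.Theory Num.Theory.
Import numFieldNormedType.Exports.
Local Open Scope classical_set_scope.
Local Open Scope ring_scope.

(* Spaces are over a scalar field that is either the real field R or the complex
   field R[i].  MathComp norms take their values in the scalar field, hence the
   maps ofR (the inclusion of R) and toR (the real part) below: the norm of x is
   ofR (rnorm x), with rnorm x in R. *)
Variant scalar_kind := RealScalars | ComplexScalars.

Definition scalars (R : realType) (k : scalar_kind) : numFieldType :=
  match k with RealScalars => R | ComplexScalars => R[i] end.

Section Scalars.
Variables (R : realType) (k : scalar_kind).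
Local Notation K := (scalars R k).

Definition ofR : R -> K :=
  match k return R -> scalars R k with
  | RealScalars => id
  | ComplexScalars => fun r => Complex r 0
  end.

Definition toR : K -> R :=
  match k return scalars R k -> R with
  | RealScalars => id
  | ComplexScalars => @complex.Re R
  end.

Lemma ofRK : cancel ofR toR.
Proof. by rewrite /ofR /toR; case: (k). Qed.

Lemma ofRD : {morph ofR : x y / x + y}.
Proof.
rewrite /ofR; case: (k) => //= x y.
by apply/eqP; rewrite eq_complex /= addr0 !eqxx.
Qed.

Lemma ofRM : {morph ofR : x y / x * y}.
Proof.
rewrite /ofR; case: (k) => //= x y.
by apply/eqP; rewrite eq_complex /= !mulr0 !mul0r subr0 addr0 !eqxx.
Qed.

Lemma ofR0 : ofR 0 = 0.
Proof. by rewrite /ofR; case: (k). Qed.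

Lemma ler_ofR : {mono ofR : x y / x <= y}.
Proof. by rewrite /ofR; case: (k) => //= x y; rewrite lecE /= eqxx. Qed.

Lemma toRK (x : K) : 0 <= x -> ofR (toR x) = x.
Proof.
move: x; rewrite /ofR /toR; case: (k) => //= -[a b].
by rewrite lecE /= => /andP[/eqP <- _].
Qed.
End Scalars.

Section RealNorm.
Variables (R : realType) (k : scalar_kind).
Local Notation K := (scalars R k).

Definition rnorm (V : normedZmodType K) (x : V) : R := toR `|x|.

Section NormedZmod.
Variable V : normedZmodType K.
Implicit Types x y : V.

Lemma rnormE x : ofR k (rnorm x) = `|x|.
Proof. exact/toRK/normr_ge0. Qed.

Lemma rnorm_ge0 x : 0 <= rnorm x.
Proof. by rewrite -(ler_ofR k) ofR0 rnormE normr_ge0. Qed.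

Lemma rnormD x y : rnorm (x + y) <= rnorm x + rnorm y.
Proof. by rewrite -(ler_ofR k) ofRD !rnormE ler_normD. Qed.

Lemma rnormN x : rnorm (- x) = rnorm x.
Proof. by rewrite /rnorm normrN. Qed.

Lemma rnormB x y : rnorm (x - y) <= rnorm x + rnorm y.
Proof. by rewrite -(rnormN y) rnormD. Qed.

Lemma rnorm0 : rnorm (0 : V) = 0.
Proof. by rewrite /rnorm normr0 -(ofR0 R k) ofRK. Qed.

Lemma rnorm0_eq0 x : rnorm x = 0 -> x = 0.
Proof. by move=> x0; apply/normr0_eq0; rewrite -rnormE x0 ofR0. Qed.

Lemma ler_rnorm_dist x y : `|rnorm x - rnorm y| <= rnorm (x - y).
Proof.
rewrite ler_norml lerNl opprB !lerBlDr; apply/andP; split.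
  by rewrite -(rnormN (x - y)) opprB -{1}(subrK x y) rnormD.
by rewrite -{1}(subrK y x) rnormD.
Qed.

End NormedZmod.

Lemma rnormZ (V : normedModType K) (a : K) (x : V) :
  rnorm (a *: x) = rnorm a * rnorm x.
Proof. by apply: (can_inj (@ofRK R k)); rewrite ofRM !rnormE normrZ. Qed.

Lemma rnormM (a b : K) : rnorm (a * b) = rnorm a * rnorm b.
Proof. by apply: (can_inj (@ofRK R k)); rewrite ofRM !rnormE normrM. Qed.

Lemma rnorm_ofR (r : R) : 0 <= r -> rnorm (ofR k r) = r.
Proof.
move=> r0; apply: (can_inj (@ofRK R k)); rewrite rnormE ger0_norm//.
by rewrite -(ofR0 R k) ler_ofR.
Qed.

End RealNorm.

Section BoundedOperators.
Variables (R : realType) (k : scalar_kind).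
Local Notation K := (scalars R k).
Variables (E F : normedModType K).

Definition bounded_linear : {pred E -> F} := fun f =>
  `[< linear f /\ exists M : R, forall x, rnorm (f x) <= M * rnorm x >].

Record bop := Bop { bop_fun :> E -> F ; _ : bop_fun \in bounded_linear }.

HB.instance Definition _ := [isSub for bop_fun].
HB.instance Definition _ := [Choice of bop by <:].

Lemma bopP (f g : bop) : f =1 g -> f = g.
Proof. by move=> fg; apply/val_inj/funext. Qed.

Lemma bop_linear (f : bop) : linear f.
Proof. by case: f => f /= /asboolP[]. Qed.

HB.instance Definition _ (f : bop) :=
  GRing.isLinear.Build K E F *:%R (bop_fun f) (@bop_linear f).

Lemma bop_bounded (f : bop) : exists2 M : R, 0 <= M &
  forall x, rnorm (f x) <= M * rnorm x.
Proof.
case: f => f /= /asboolP[_ [M fM]]; exists `|M| => // x.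
by rewrite (le_trans (fM x))// ler_wpM2r ?rnorm_ge0// ler_norm.
Qed.

Lemma bounded_linear_submod : submod_closed bounded_linear.
Proof.
split=> [|a f g /asboolP[fl [M fM]] /asboolP[gl [N gN]]]; apply/asboolP; split.
- by move=> b x y /=; rewrite scaler0 addr0.
- by exists 0 => x; rewrite rnorm0 mul0r.
- move=> b x y; rewrite !fctE fl gl !scalerDr !scalerA (mulrC a b) -!addrA.
  by congr (_ + _); rewrite addrCA.
- exists (rnorm a * M + N) => x; rewrite mulrDl (le_trans (rnormD _ _))//.
  by rewrite lerD// rnormZ -mulrA ler_wpM2l// rnorm_ge0.
Qed.

HB.instance Definition _ :=
  GRing.isSubmodClosed.Build K (E -> F) bounded_linear bounded_linear_submod.
HB.instance Definition _ := [SubChoice_isSubLmodule of bop by <:].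

Definition opnorm (f : bop) : R :=
  sup [set rnorm (f x) | x in [set x | rnorm x <= 1]].

Lemma opnorm_has_sup (f : bop) :
  has_sup [set rnorm (f x) | x in [set x | rnorm x <= 1]].
Proof.
split; first by exists (rnorm (f 0)), 0; rewrite //= rnorm0.
have [M M0 fM] := bop_bounded f; exists M => _ [x /= x1 <-].
by rewrite (le_trans (fM x))// ler_piMr.
Qed.

Lemma opnorm_ub (f : bop) x : rnorm x <= 1 -> rnorm (f x) <= opnorm f.
Proof.
by move=> x1; apply: (sup_upper_bound (opnorm_has_sup f)); exists x.
Qed.

Lemma opnorm_ge0 (f : bop) : 0 <= opnorm f.
Proof. by rewrite (le_trans (rnorm_ge0 (f 0)))// opnorm_ub// rnorm0. Qed.

Lemma opnorm_le (f : bop) x : rnorm (f x) <= opnorm f * rnorm x.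
Proof.
have [x0|x0] := eqVneq (rnorm x) 0.
  by rewrite x0 mulr0 (rnorm0_eq0 x0) linear0 rnorm0.
have {}x0 : 0 < rnorm x by rewrite lt_def x0 rnorm_ge0.
rewrite -ler_pdivrMr// mulrC.
have := @opnorm_ub f (ofR k (rnorm x)^-1 *: x).
rewrite linearZ /= !rnormZ rnorm_ofR ?invr_ge0 ?(ltW x0)//.
by apply; rewrite mulVf// gt_eqF.
Qed.

Lemma opnorm_lub (f : bop) (M : R) : 0 <= M ->
  (forall x, rnorm (f x) <= M * rnorm x) -> opnorm f <= M.
Proof.
move=> M0 fM; apply: ge_sup; first by have [] := opnorm_has_sup f.
by move=> _ [x /= x1 <-]; rewrite (le_trans (fM x))// ler_piMr.
Qed.

Let bop_norm (f : bop) : K := ofR k (opnorm f).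

Lemma bop_normD f g : bop_norm (f + g) <= bop_norm f + bop_norm g.
Proof.
rewrite /bop_norm -ofRD ler_ofR opnorm_lub ?addr_ge0 ?opnorm_ge0// => x.
by rewrite (le_trans (rnormD _ _))// mulrDl lerD// opnorm_le.
Qed.

Lemma opnormZ_le (a : K) f : opnorm (a *: f) <= rnorm a * opnorm f.
Proof.
rewrite opnorm_lub// ?mulr_ge0 ?rnorm_ge0 ?opnorm_ge0// => x.
by rewrite [leLHS]rnormZ -mulrA ler_wpM2l ?rnorm_ge0 ?opnorm_le.
Qed.

Lemma bop_normZ (a : K) f : bop_norm (a *: f) = `|a| * bop_norm f.
Proof.
rewrite /bop_norm -rnormE -ofRM; congr (ofR k _).
apply/eqP; rewrite eq_le opnormZ_le /=.
have [->|a0] := eqVneq a 0; first by rewrite rnorm0 mul0r opnorm_ge0.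
have {1}-> : f = a^-1 *: (a *: f) by rewrite scalerA mulVf// scale1r.
rewrite (le_trans (ler_wpM2l (rnorm_ge0 _) (opnormZ_le _ _)))//.
rewrite mulrA -rnormM mulfV// ler_piMl ?opnorm_ge0//.
by rewrite -[leRHS](@rnorm_ofR R k) // /ofR; case: (k).
Qed.

Lemma bop_norm_eq0 f : bop_norm f = 0 -> f = 0.
Proof.
rewrite /bop_norm -(ofR0 R k) => /(can_inj (@ofRK R k)) f0.
apply: bopP => x; apply: rnorm0_eq0; apply/eqP.
by rewrite eq_le rnorm_ge0 (le_trans (opnorm_le f x))// f0 mul0r.
Qed.

HB.instance Definition _ :=
  Lmodule_isNormed.Build K bop bop_normD bop_normZ bop_norm_eq0.

Lemma rnorm_bopE (f : bop) : rnorm f = opnorm f.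
Proof. exact: ofRK. Qed.

End BoundedOperators.

(* MathComp rings are unital; Banach algebras need not be, so the product is an
   operation on top of a normed module. *)
HB.mixin Record NormedModule_isNormedAlgebra (K : numFieldType) A
    & NormedModule K A := {
  amul : A -> A -> A ;
  amulA : associative amul ;
  amulDl : left_distributive amul +%R ;
  amulDr : right_distributive amul +%R ;
  amulZl : forall (c : K) a b, amul (c *: a) b = c *: amul a b ;
  amulZr : forall (c : K) a b, amul a (c *: b) = c *: amul a b ;
  ler_norm_amul : forall a b, `|amul a b| <= `|a| * `|b|
}.

#[short(type="normedAlgType")]
HB.structure Definition NormedAlgebra (K : numFieldType) :=
  {A of NormedModule K A & NormedModule_isNormedAlgebra K A}.

#[short(type="banachAlgType")]
HB.structure Definition BanachAlgebra (K : numFieldType) :=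
  {A of NormedAlgebra K A & Complete A}.

Section NormedAlgebraTheory.
Variables (K : numFieldType) (A : normedAlgType K).
Implicit Types a b : A.

Lemma amulNl a b : amul (- a) b = - amul a b.
Proof. by rewrite -scaleN1r amulZl scaleN1r. Qed.

Lemma amulNr a b : amul a (- b) = - amul a b.
Proof. by rewrite -scaleN1r amulZr scaleN1r. Qed.

End NormedAlgebraTheory.

Section OperatorAlgebra.
Variables (R : realType) (k : scalar_kind).
Local Notation K := (scalars R k).

Lemma bounded_linear_comp (E F G : normedModType K) (g : bop F G) (f : bop E F) :
  (g \o f : E -> G) \in @bounded_linear R k E G.
Proof.
apply/asboolP; split=> [a x y /=|]; first by rewrite !linearP.
exists (opnorm g * opnorm f) => x /=.
rewrite (le_trans (opnorm_le _ _))// -mulrA ler_wpM2l ?opnorm_ge0//.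
exact: opnorm_le.
Qed.

Definition bop_comp (E F G : normedModType K) (g : bop F G) (f : bop E F) :
  bop E G := Bop (bounded_linear_comp g f).

Variable E : normedModType K.
Local Notation BE := (bop E E).

Let compA : associative (@bop_comp E E E).
Proof. by move=> f g h; apply: bopP. Qed.

Let compDl : left_distributive (@bop_comp E E E) +%R.
Proof. by move=> f g h; apply: bopP. Qed.

Let compDr : right_distributive (@bop_comp E E E) +%R.
Proof. by move=> f g h; apply: bopP => x; exact: raddfD. Qed.

Let compZl (c : K) (f g : BE) : bop_comp (c *: f) g = c *: bop_comp f g.
Proof. exact: bopP. Qed.

Let compZr (c : K) (f g : BE) : bop_comp f (c *: g) = c *: bop_comp f g.
Proof. by apply: bopP => x; exact: linearZ. Qed.

Let norm_comp (f g : BE) : `|bop_comp f g| <= `|f| * `|g|.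
Proof.
rewrite -!rnormE -ofRM ler_ofR !rnorm_bopE.
rewrite opnorm_lub ?mulr_ge0 ?opnorm_ge0// => x /=.
rewrite (le_trans (opnorm_le _ _))// -mulrA ler_wpM2l ?opnorm_ge0//.
exact: opnorm_le.
Qed.

HB.instance Definition _ := @NormedModule_isNormedAlgebra.Build K BE
  (@bop_comp E E E) compA compDl compDr compZl compZr norm_comp.

End OperatorAlgebra.

Section Duality.
Variables (R : realType) (k : scalar_kind).
Local Notation K := (scalars R k).

Definition dual (E : normedModType K) := bop E K^o.

Definition bidual (E : normedModType K) := dual (dual E).

Lemma evaluation_bounded_linear (E : normedModType K) (x : E) :
  (fun mu : dual E => mu x) \in @bounded_linear R k (dual E) K^o.
Proof.
apply/asboolP; split=> //; exists (rnorm x) => mu.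
by rewrite rnorm_bopE mulrC opnorm_le.
Qed.

(* The canonical embedding of E into its bidual. *)
Definition evaluation (E : normedModType K) (x : E) : bidual E :=
  Bop (evaluation_bounded_linear x).

Definition reflexive_space (E : normedModType K) : Prop :=
  forall Phi : bidual E, exists x : E, evaluation x = Phi.

End Duality.

Section ArensProducts.
Variables (R : realType) (k : scalar_kind).
Local Notation K := (scalars R k).
Variable A : normedAlgType K.
Implicit Types (a b : A) (mu : dual A) (Phi Psi : bidual A).

Lemma rnorm_amul a b : rnorm (amul a b) <= rnorm a * rnorm b.
Proof. by rewrite -(ler_ofR k) ofRM !rnormE ler_norm_amul. Qed.

Lemma dual_lact_bounded_linear a mu :
  (fun b => mu (amul b a)) \in @bounded_linear R k A K^o.
Proof.
apply/asboolP; split=> [c x y|]; first by rewrite amulDl amulZl linearP.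
exists (opnorm mu * rnorm a) => x; rewrite (le_trans (opnorm_le _ _))//.
by rewrite -mulrA ler_wpM2l ?opnorm_ge0// mulrC rnorm_amul.
Qed.

(* (a . mu)(b) = mu(b a) *)
Definition dual_lact a mu : dual A := Bop (dual_lact_bounded_linear a mu).

Lemma dual_ract_bounded_linear mu a :
  (fun b => mu (amul a b)) \in @bounded_linear R k A K^o.
Proof.
apply/asboolP; split=> [c x y|]; first by rewrite amulDr amulZr linearP.
exists (opnorm mu * rnorm a) => x; rewrite (le_trans (opnorm_le _ _))//.
by rewrite -mulrA ler_wpM2l ?opnorm_ge0// rnorm_amul.
Qed.

(* (mu . a)(b) = mu(a b) *)
Definition dual_ract mu a : dual A := Bop (dual_ract_bounded_linear mu a).

Lemma opnorm_dual_lact a mu : opnorm (dual_lact a mu) <= opnorm mu * rnorm a.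
Proof.
rewrite opnorm_lub ?mulr_ge0 ?opnorm_ge0 ?rnorm_ge0// => x /=.
rewrite (le_trans (opnorm_le _ _))//.
by rewrite -mulrA ler_wpM2l ?opnorm_ge0// mulrC rnorm_amul.
Qed.

Lemma opnorm_dual_ract mu a : opnorm (dual_ract mu a) <= opnorm mu * rnorm a.
Proof.
rewrite opnorm_lub ?mulr_ge0 ?opnorm_ge0 ?rnorm_ge0// => x /=.
rewrite (le_trans (opnorm_le _ _))//.
by rewrite -mulrA ler_wpM2l ?opnorm_ge0// rnorm_amul.
Qed.

Lemma bidual_lact_bounded_linear Phi mu :
  (fun a => Phi (dual_ract mu a)) \in @bounded_linear R k A K^o.
Proof.
apply/asboolP; split=> [c x y|].
  rewrite -(linearP Phi); congr (Phi _); apply: bopP => z /=.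
  by rewrite amulDl amulZl linearP.
exists (opnorm Phi * opnorm mu) => x; rewrite (le_trans (opnorm_le _ _))//.
by rewrite -mulrA ler_wpM2l ?opnorm_ge0// rnorm_bopE opnorm_dual_ract.
Qed.

(* (Phi . mu)(a) = Phi(mu . a) *)
Definition bidual_lact Phi mu : dual A :=
  Bop (bidual_lact_bounded_linear Phi mu).

Lemma bidual_ract_bounded_linear mu Phi :
  (fun a => Phi (dual_lact a mu)) \in @bounded_linear R k A K^o.
Proof.
apply/asboolP; split=> [c x y|].
  rewrite -(linearP Phi); congr (Phi _); apply: bopP => z /=.
  by rewrite amulDr amulZr linearP.
exists (opnorm Phi * opnorm mu) => x; rewrite (le_trans (opnorm_le _ _))//.
by rewrite -mulrA ler_wpM2l ?opnorm_ge0// rnorm_bopE opnorm_dual_lact.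
Qed.

(* (mu . Phi)(a) = Phi(a . mu) *)
Definition bidual_ract mu Phi : dual A :=
  Bop (bidual_ract_bounded_linear mu Phi).

Lemma opnorm_bidual_lact Phi mu :
  opnorm (bidual_lact Phi mu) <= opnorm Phi * opnorm mu.
Proof.
rewrite opnorm_lub ?mulr_ge0 ?opnorm_ge0// => x /=.
rewrite (le_trans (opnorm_le _ _))//.
by rewrite -mulrA ler_wpM2l ?opnorm_ge0// rnorm_bopE opnorm_dual_ract.
Qed.

Lemma opnorm_bidual_ract mu Phi :
  opnorm (bidual_ract mu Phi) <= opnorm Phi * opnorm mu.
Proof.
rewrite opnorm_lub ?mulr_ge0 ?opnorm_ge0// => x /=.
rewrite (le_trans (opnorm_le _ _))//.
by rewrite -mulrA ler_wpM2l ?opnorm_ge0// rnorm_bopE opnorm_dual_lact.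
Qed.

Lemma arens1_bounded_linear Phi Psi :
  (fun mu => Phi (bidual_lact Psi mu)) \in @bounded_linear R k (dual A) K^o.
Proof.
apply/asboolP; split=> [c mu nu|].
  rewrite -(linearP Phi); congr (Phi _); apply: bopP => a /=.
  apply: (eq_trans _ (linearP Psi c (dual_ract mu a) (dual_ract nu a))).
  by congr (Psi _); apply: bopP.
exists (opnorm Phi * opnorm Psi) => mu; rewrite (le_trans (opnorm_le _ _))//.
by rewrite -mulrA ler_wpM2l ?opnorm_ge0// !rnorm_bopE opnorm_bidual_lact.
Qed.

(* First Arens product: mu |-> Phi(Psi . mu). *)
Definition arens1 Phi Psi : bidual A := Bop (arens1_bounded_linear Phi Psi).

Lemma arens2_bounded_linear Phi Psi :
  (fun mu => Psi (bidual_ract mu Phi)) \in @bounded_linear R k (dual A) K^o.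
Proof.
apply/asboolP; split=> [c mu nu|].
  rewrite -(linearP Psi); congr (Psi _); apply: bopP => a /=.
  apply: (eq_trans _ (linearP Phi c (dual_lact a mu) (dual_lact a nu))).
  by congr (Phi _); apply: bopP.
exists (opnorm Psi * opnorm Phi) => mu; rewrite (le_trans (opnorm_le _ _))//.
by rewrite -mulrA ler_wpM2l ?opnorm_ge0// !rnorm_bopE opnorm_bidual_ract.
Qed.

(* Second Arens product: mu |-> Psi(mu . Phi). *)
Definition arens2 Phi Psi : bidual A := Bop (arens2_bounded_linear Phi Psi).

(* Completeness of A plays no role in the definition, so it is given for normed
   algebras; it is applied to ultrapowers without recording that they are
   complete. *)
Definition arens_regular : Prop :=
  forall Phi Psi : bidual A, arens1 Phi Psi = arens2 Phi Psi.

End ArensProducts.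

Section BoundedFamilies.
Variables (R : realType) (k : scalar_kind) (I : Type).
Local Notation K := (scalars R k).

Section Module.
Variable E : normedModType K.

Definition bounded_family : {pred I -> E} := fun x =>
  `[< exists M : R, forall i, rnorm (x i) <= M >].

Record linfty := Linfty { fam :> I -> E ; _ : fam \in bounded_family }.

HB.instance Definition _ := [isSub for fam].
HB.instance Definition _ := [Choice of linfty by <:].

Lemma linftyP (x y : linfty) : x =1 y -> x = y.
Proof. by move=> xy; apply/val_inj/funext. Qed.

Lemma linfty_bounded (x : linfty) : exists2 M : R, 0 <= M &
  forall i, rnorm (x i) <= M.
Proof.
case: x => x /= /asboolP[M xM]; exists `|M| => // i.
by rewrite (le_trans (xM i))// ler_norm.
Qed.

Lemma bounded_family_submod : submod_closed bounded_family.
Proof.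
split=> [|a x y /asboolP[M xM] /asboolP[N yN]]; apply/asboolP.
  by exists 0 => i; rewrite rnorm0.
exists (rnorm a * M + N) => i; rewrite (le_trans (rnormD _ _))//.
by rewrite lerD// rnormZ ler_wpM2l// rnorm_ge0.
Qed.

HB.instance Definition _ :=
  GRing.isSubmodClosed.Build K (I -> E) bounded_family bounded_family_submod.
HB.instance Definition _ := [SubChoice_isSubLmodule of linfty by <:].

End Module.

Variable A : normedAlgType K.

Lemma bounded_family_mul (x y : linfty A) :
  (fun i => amul (x i) (y i)) \in @bounded_family A.
Proof.
have [M M0 xM] := linfty_bounded x; have [N N0 yN] := linfty_bounded y.
apply/asboolP; exists (M * N) => i; rewrite (le_trans (rnorm_amul _ _))//.
by rewrite ler_pM ?rnorm_ge0.
Qed.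

Definition linfty_mul (x y : linfty A) := Linfty (bounded_family_mul x y).

End BoundedFamilies.

Section Ultrapower.
Variables (R : realType) (k : scalar_kind).
Local Notation K := (scalars R k).
Variables (I : Type) (U : set_system I).
Context {UU : UltraFilter U}.

Lemma ler_cvg_ultra (f g : I -> R) (l l' : R) :
  f i @[i --> U] --> l -> g i @[i --> U] --> l' ->
  (forall i, f i <= g i) -> l <= l'.
Proof.
move=> fl gl fg; rewrite -subr_ge0.
apply: (cvgr_to_ge (cvgB gl fl)).
by apply: nearW => i /=; rewrite subr_ge0.
Qed.

Section Module.
Variable E : normedModType K.
Local Notation linf := (linfty I E).

Lemma linfty_cvg (x : linf) : cvg (rnorm (x i) @[i --> U]).
Proof.
have [M M0 xM] := linfty_bounded x.
have Uf : UltraFilter ((fun i => rnorm (x i)) @ U).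
  split=> [|G PG UG]; first exact: fmap_proper_filter.
  apply/seteqP; split=> // B GB.
  have [//|nB] := in_ultra_setVsetC ((fun i => rnorm (x i)) @^-1` B) UU.
  have : G (B `&` ~` B) by apply: filterI => //; exact: UG.
  by rewrite setICr => /(filter_not_empty_ex (@filter_ex _ G _))[].
have Ub : ((fun i => rnorm (x i)) @ U) `[0, M]%classic.
  by apply: (@filterE _ U) => i /=; rewrite in_itv /= rnorm_ge0 xM.
have := @segment_compact R 0 M; rewrite compact_ultra => /(_ _ Uf Ub)[l [_ xl]].
by apply/cvg_ex; exists l.
Qed.

Definition null_family : {pred linf} := fun x =>
  `[< rnorm (x i) @[i --> U] --> (0 : R) >].

Lemma null_family_submod : submod_closed null_family.
Proof.
split=> [|a x y /asboolP x0 /asboolP y0]; apply/asboolP.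
  by under eq_fun do rewrite rnorm0; exact: cvg_cst.
apply: (@squeeze_cvgr _ _ _ _ (fun=> 0)
  (fun i => rnorm a * rnorm (x i) + rnorm (y i))).
- by apply: nearW => i; rewrite rnorm_ge0 /= (le_trans (rnormD _ _))// rnormZ.
- exact: cvg_cst.
- have -> : 0 = rnorm a * 0 + 0 :> R by rewrite mulr0 addr0.
  by apply: cvgD => //; exact: cvgMr.
Qed.

HB.instance Definition _ :=
  GRing.isSubmodClosed.Build K linf null_family null_family_submod.

Definition ultrapower : Type := Quotient.quot null_family.

Definition upi (x : linf) : ultrapower := \pi_(Quotient.quot null_family)%qT x.
Definition urepr (q : ultrapower) : linf := repr q.

HB.instance Definition _ := GRing.Zmodule.on ultrapower.

Lemma ureprK : cancel urepr upi.
Proof. exact: reprK. Qed.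

Lemma upiP (x y : linf) : upi x = upi y <->
  rnorm (x i - y i) @[i --> U] --> (0 : R).
Proof.
have := @Quotient.idealrBE linf null_family x y => xyE.
by split=> [/eqP|xy]; [|apply/eqP]; rewrite -xyE; [move/asboolP|apply/asboolP].
Qed.

Lemma upiD (x y : linf) : upi (x + y) = upi x + upi y.
Proof. exact: (@raddfD _ _ (\pi_(Quotient.quot null_family)%qT)). Qed.

Definition uscale (a : K) (q : ultrapower) : ultrapower := upi (a *: urepr q).

Lemma upi_uscale (a : K) (x : linf) : upi (a *: x) = uscale a (upi x).
Proof.
apply/upiP.
have := ureprK (upi x) => /upiP xr.
have -> : 0 = rnorm a * 0 :> R by rewrite mulr0.
have -> : (fun i => rnorm ((a *: x) i - (a *: urepr (upi x)) i)) =
          (fun i => rnorm a * rnorm (urepr (upi x) i - x i)).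
  by apply/funext => i; rewrite -rnormZ -rnormN opprB scalerBr.
exact: cvgMr.
Qed.

Let uscaleA a b q : uscale a (uscale b q) = uscale (a * b) q.
Proof. by rewrite -(ureprK q) -!upi_uscale scalerA. Qed.

Let uscale1 : left_id 1 uscale.
Proof. by move=> q; rewrite -(ureprK q) -!upi_uscale scale1r. Qed.

Let uscaleDr : right_distributive uscale +%R.
Proof.
by move=> a p q; rewrite -(ureprK p) -(ureprK q) -upiD -!upi_uscale scalerDr upiD.
Qed.

Let uscaleDl q : {morph uscale^~ q : a b / a + b}.
Proof. by move=> a b; rewrite -(ureprK q) -!upi_uscale scalerDl upiD. Qed.

HB.instance Definition _ := GRing.Zmodule_isLmodule.Build K ultrapower
  uscaleA uscale1 uscaleDr uscaleDl.

Lemma upiZ (a : K) (x : linf) : upi (a *: x) = a *: upi x.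
Proof. exact: upi_uscale. Qed.

(* unorm_upi: the limit does not depend on the representative family. *)
Definition unorm (q : ultrapower) : R := lim (rnorm (urepr q i) @[i --> U]).

Lemma unorm_upi (x : linf) : unorm (upi x) = lim (rnorm (x i) @[i --> U]).
Proof.
apply/eqP; rewrite -subr_eq0 -limB; [|exact: linfty_cvg..].
apply/eqP/cvg_lim; first exact: Rhausdorff.
have := ureprK (upi x) => /upiP xr.
apply/norm_cvg0P; apply: (@squeeze_cvgr _ _ _ _ (fun=> 0) _ _ _ _ _ xr).
  by apply: nearW => i; rewrite normr_ge0 ler_rnorm_dist.
exact: cvg_cst.
Qed.

Lemma unorm_ge0 q : 0 <= unorm q.
Proof.
by apply: limr_ge; [exact: linfty_cvg|apply: nearW => i; exact: rnorm_ge0].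
Qed.

Let norm (q : ultrapower) : K := ofR k (unorm q).

Let normD p q : norm (p + q) <= norm p + norm q.
Proof.
rewrite /norm -ofRD ler_ofR -(ureprK p) -(ureprK q) -upiD !unorm_upi.
apply: (ler_cvg_ultra (@linfty_cvg (urepr p + urepr q))
  (cvgD (@linfty_cvg (urepr p)) (@linfty_cvg (urepr q)))).
by move=> i; exact: rnormD.
Qed.

Let normZ (a : K) q : norm (a *: q) = `|a| * norm q.
Proof.
rewrite /norm -rnormE -ofRM; congr (ofR k _); rewrite -(ureprK q).
rewrite -upiZ !unorm_upi; under eq_fun do rewrite rnormZ.
apply/cvg_lim; first exact: Rhausdorff.
by apply: cvgMr; exact: linfty_cvg.
Qed.

Let norm_eq0 q : norm q = 0 -> q = 0.
Proof.
rewrite /norm -(ofR0 R k) => /(can_inj (@ofRK R k)); rewrite -(ureprK q).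
rewrite unorm_upi => q0.
have -> : 0 = upi 0 by rewrite /upi raddf0.
apply/upiP; under eq_fun do rewrite subr0.
by rewrite -q0; exact: linfty_cvg.
Qed.

HB.instance Definition _ :=
  Lmodule_isNormed.Build K ultrapower normD normZ norm_eq0.

Lemma rnorm_upi (x : linf) : rnorm (upi x) = lim (rnorm (x i) @[i --> U]).
Proof. by rewrite -unorm_upi; exact: ofRK. Qed.

End Module.

Section Algebra.
Variable A : normedAlgType K.
Local Notation linf := (linfty I A).
Local Notation uA := (ultrapower A).

Definition umul (p q : uA) : uA := upi (linfty_mul (urepr p) (urepr q)).

Lemma upiM (x y : linf) : upi (linfty_mul x y) = umul (upi x) (upi y).
Proof.
apply/upiP.
have := ureprK (upi x) => /upiP xr; have := ureprK (upi y) => /upiP yr.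
have [M M0 xM] := linfty_bounded (urepr (upi x)).
have [N N0 yN] := linfty_bounded y.
apply: (@squeeze_cvgr _ _ _ _ (fun=> 0) (fun i =>
  rnorm (urepr (upi x) i - x i) * N + M * rnorm (urepr (upi y) i - y i))).
- apply: nearW => i; rewrite rnorm_ge0 /=.
  set x' := urepr (upi x) i; set y' := urepr (upi y) i.
  have -> : amul (x i) (y i) - amul x' y' =
            - (amul (x' - x i) (y i) + amul x' (y' - y i)).
    by rewrite amulDl amulDr amulNl amulNr [in RHS]addrC addrA subrK opprB.
  rewrite rnormN (le_trans (rnormD _ _))//.
  apply: lerD; apply: (le_trans (rnorm_amul _ _)).
    by rewrite ler_wpM2l ?rnorm_ge0 ?yN.
  by rewrite ler_wpM2r ?rnorm_ge0 ?xM.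
- exact: cvg_cst.
- have -> : 0 = 0 * N + M * 0 :> R by rewrite mulr0 mul0r addr0.
  by apply: cvgD; [exact: cvgMl|exact: cvgMr].
Qed.

Let umulA : associative umul.
Proof.
move=> p q r; rewrite -(ureprK p) -(ureprK q) -(ureprK r) -!upiM.
by congr upi; apply: linftyP => i /=; rewrite amulA.
Qed.

Let umulDl : left_distributive umul +%R.
Proof.
move=> p q r; rewrite -(ureprK p) -(ureprK q) -(ureprK r) -!upiM -upiD -!upiM -upiD.
by congr upi; apply: linftyP => i /=; exact: amulDl.
Qed.

Let umulDr : right_distributive umul +%R.
Proof.
move=> p q r; rewrite -(ureprK p) -(ureprK q) -(ureprK r) -!upiM -upiD -!upiM -upiD.
by congr upi; apply: linftyP => i /=; exact: amulDr.
Qed.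

Let umulZl (c : K) p q : umul (c *: p) q = c *: umul p q.
Proof.
rewrite -(ureprK p) -(ureprK q) -[c *: upi (urepr p)]upiZ -!upiM -upiZ.
by congr upi; apply: linftyP => i /=; exact: amulZl.
Qed.

Let umulZr (c : K) p q : umul p (c *: q) = c *: umul p q.
Proof.
rewrite -(ureprK p) -(ureprK q) -[c *: upi (urepr q)]upiZ -!upiM -upiZ.
by congr upi; apply: linftyP => i /=; exact: amulZr.
Qed.

Let norm_umul p q : `|umul p q| <= `|p| * `|q|.
Proof.
rewrite -!rnormE -ofRM ler_ofR -(ureprK p) -(ureprK q) -upiM !rnorm_upi.
apply: (ler_cvg_ultra (@linfty_cvg _ (linfty_mul (urepr p) (urepr q)))
  (cvgM (@linfty_cvg _ (urepr p)) (@linfty_cvg _ (urepr q)))).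
by move=> i; exact: rnorm_amul.
Qed.

HB.instance Definition _ := @NormedModule_isNormedAlgebra.Build K uA
  umul umulA umulDl umulDr umulZl umulZr norm_umul.

End Algebra.
End Ultrapower.

Arguments ultrapower {R k I} U {UU} E.

Section SuperProperties.
Variables (R : realType) (k : scalar_kind).
Local Notation K := (scalars R k).

Definition super_reflexive (E : normedModType K) : Prop :=
  forall (I : Type) (U : set_system I) (UU : UltraFilter U),
    reflexive_space (ultrapower U E).

Definition super_arens_regular (A : normedAlgType K) : Prop :=
  forall (I : Type) (U : set_system I) (UU : UltraFilter U),
    arens_regular (ultrapower U A).

End SuperProperties.

Section Subalgebras.
Variable K : numFieldType.

Definition closed_subalgebra (B : normedAlgType K) (S : set B) : Prop :=
  [/\ closed S, S 0,
      forall (c : K) x y, S x -> S y -> S (c *: x + y) &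
      forall x y, S x -> S y -> S (amul x y)].

(* f is an isomorphism of Banach algebras from A onto the subalgebra S of B,
   i.e. linear, multiplicative and bicontinuous (not necessarily isometric). *)
Definition algebra_iso_onto (A B : normedAlgType K) (S : set B) (f : A -> B) :
  Prop :=
  [/\ linear f, {morph f : a b / amul a b}, set_bij [set: A] S f,
      continuous f &
      exists2 g : B -> A, cancel f g & {within S, continuous g}].

End Subalgebras.

(* Main.v *)
(* Let C be an ultrapower of A and mu a functional on C. Real parts of values
   (g, c x) of the operator representation, computed along the ultrafilter, are
   functions h_c on the set of all families of pairs (g, x) in the unit balls of
   E' and E, and sup h_c is equivalent to the norm of c. By Hahn-Banach there is
   a positive functional nu on all bounded functions of (g, x) with
   nu(h_c) = Re mu(c), and <v, w> = nu(v w) is a semi-inner product. If the two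
   Arens products of Phi and Psi differ at mu, then Goldstine's theorem,
   improved by Mazur's theorem to norm closeness for <., .>, gives
   sequences a_m, b_n in a ball of C such that the functions h_(a_m b_n) nearly
   coincide for all m <= n, nearly coincide for all m > n, while the two common
   values have different nu-integrals. At some point of the domain one therefore
   sees arbitrarily long patterns
     Re g_m(y_n) >= Re g_m'(y_n') + eps  for m <= n and m' > n',
   with bounded g_m in E' and y_n in E and with a fixed eps > 0. Their limit in
   an ultrapower of E over nat contradicts the reflexivity of that ultrapower. *)
From HB Require Import structures.
Require Import Defs.
From mathcomp Require Import all_boot all_order all_algebra complex ring lra.
From mathcomp Require Import all_classical reals topology normedtype.
Set Implicit Arguments.
Unset Strict Implicit.
Unset Printing Implicit Defensive.
Import Order.TTheory GRing.Theory Num.Theory.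
Import numFieldNormedType.Exports.
Local Open Scope classical_set_scope.
Local Open Scope ring_scope.

(** * Real parts and real-linear functionals *)

Section RealParts.
Variables (R : realType) (k : scalar_kind).
Local Notation K := (scalars R k).

Lemma ofR1 : ofR k 1 = 1 :> K.
Proof. by rewrite /ofR; case: (k). Qed.

Lemma toR1 : toR (1 : K) = 1.
Proof. by rewrite -ofR1 ofRK. Qed.

Lemma ofRN (r : R) : ofR k (- r) = - ofR k r.
Proof. by apply: (addrI (ofR k r)); rewrite -ofRD !subrr ofR0. Qed.

Lemma toRD (x y : K) : toR (x + y) = toR x + toR y.
Proof. by move: x y; rewrite /toR; case: (k) => //= -[a b] [c d]. Qed.

Lemma toR0 : toR (0 : K) = 0.
Proof. by rewrite -(ofR0 R k) ofRK. Qed.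

Lemma toRN (x : K) : toR (- x) = - toR x.
Proof. by apply: (addrI (toR x)); rewrite -toRD !subrr toR0. Qed.

Lemma toRM (r : R) (x : K) : toR (ofR k r * x) = r * toR x.
Proof.
by move: x; rewrite /toR /ofR; case: (k) => //= -[a b] /=; rewrite mul0r subr0.
Qed.

Lemma toR_le_rnorm (x : K) : toR x <= rnorm (x : K^o).
Proof.
rewrite -(ler_ofR k) rnormE; move: x; rewrite /ofR /toR.
case: (k) => /= [x|[a b]]; first exact: ler_norm.
rewrite lecE /= eqxx /= (le_trans (ler_norm a))// -sqrtr_sqr ler_wsqrtr//.
by rewrite lerDl sqr_ge0.
Qed.

Lemma normr_toR (x : K) : `|toR x| <= rnorm (x : K^o).
Proof.
by rewrite ler_norml lerNl -toRN toR_le_rnorm -(rnormN (x : K^o)) toR_le_rnorm.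
Qed.

Lemma rnorm_ofR_norm (r : R) : rnorm (ofR k r : K^o) = `|r|.
Proof.
have [r0|r0] := leP 0 r; first by rewrite rnorm_ofR// ger0_norm.
by rewrite -rnormN -ofRN rnorm_ofR ?ltr0_norm ?oppr_ge0// ltW.
Qed.

(** Lets one argument serve both scalar fields. In the complex case [j] is the imaginary unit and
    [toR (- j * z)] is the imaginary part of [z]. *)
Lemma scalars_split : (forall z : K, ofR k (toR z) = z) \/
  exists2 j : K, j * j = -1 & forall r : R, toR (ofR k r * j) = 0 /\
  forall z : K, z = ofR k (toR z) + ofR k (toR (- j * z)) * j.
Proof.
rewrite /ofR /toR; case: (k) => /=; [by left|right; exists 'i%C].
  by rewrite -expr2 sqr_i.
move=> r; split=> [|[a b]]; first by rewrite /= mulr0 mul0r subrr.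
by apply/eqP; rewrite eq_complex /=; apply/andP; split; apply/eqP; ring.
Qed.

End RealParts.

Section RealLinear.
Variables (R : realType) (k : scalar_kind).
Local Notation K := (scalars R k).

Definition rlin (V : lmodType K) (rho : V -> R) : Prop :=
  forall (r : R) (x y : V), rho (ofR k r *: x + y) = r * rho x + rho y.

Section Rlin.
Variables (V : lmodType K) (rho : V -> R).
Hypothesis rhoL : rlin rho.

Lemma rlinD x y : rho (x + y) = rho x + rho y.
Proof. by have := rhoL 1 x y; rewrite ofR1 scale1r mul1r. Qed.

Lemma rlin0 : rho 0 = 0.
Proof. by apply: (addrI (rho 0)); rewrite -rlinD !addr0. Qed.

Lemma rlinZ r x : rho (ofR k r *: x) = r * rho x.
Proof. by have := rhoL r x 0; rewrite rlin0 !addr0. Qed.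

Lemma rlinN x : rho (- x) = - rho x.
Proof. by apply: (addrI (rho x)); rewrite -rlinD !subrr rlin0. Qed.

End Rlin.

Variable V : normedModType K.

Lemma rlin_toR (lambda : dual V) : rlin (fun x => toR (lambda x)).
Proof. by move=> r x y; rewrite linearP toRD toRM. Qed.

Lemma dualZ (lambda : dual V) (c : K) x : lambda (c *: x) = c * lambda x.
Proof. exact: linearZ. Qed.

(** Where the two functionals differ by some [z != 0], rescaling the point by [z^-1] makes the
    difference 1, which real parts detect. *)
Lemma dual_eq_toR (lambda lambda' : dual V) :
  (forall x, toR (lambda x) = toR (lambda' x)) -> lambda = lambda'.
Proof.
move=> ll'; apply: bopP => x; apply/eqP; rewrite -subr_eq0; apply/eqP.
set z := (X in X = 0); case: (eqVneq z 0) => // z0; exfalso.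
have : toR (lambda (z^-1 *: x) - lambda' (z^-1 *: x)) = 1.
  by rewrite !dualZ -mulrBr mulVf// toR1.
by rewrite toRD toRN ll' subrr => /eqP; rewrite eq_sym oner_eq0.
Qed.

(** Multiplying [x] by a scalar of modulus 1 turns [lambda x] into its modulus, which is its own
    real part. *)
Lemma rnorm_le_toR (lambda : dual V) (M : R) : 0 <= M ->
  (forall x, toR (lambda x) <= M * rnorm x) ->
  forall x, rnorm (lambda x) <= M * rnorm x.
Proof.
move=> M0 lM x; have [->|z0] := eqVneq (lambda x) 0.
  by rewrite rnorm0 mulr_ge0 ?rnorm_ge0.
have nz : 0 < rnorm (lambda x).
  rewrite lt_def rnorm_ge0 andbT; apply: contra_neq z0; exact: rnorm0_eq0.
have := lM ((ofR k (rnorm (lambda x)) / lambda x) *: x).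
rewrite dualZ mulfVK// ofRK rnormZ.
suff -> : rnorm (ofR k (rnorm (lambda x)) / lambda x : K^o) = 1 by rewrite mul1r.
apply: (@mulIf _ (rnorm (lambda x))); first by rewrite gt_eqF.
by rewrite -rnormM mulfVK// mul1r rnorm_ofR// ltW.
Qed.

(** Over the complex field, the functional with real part [rho] is [rho x - i rho (i x)]. *)
Lemma rlin_lift (rho : V -> R) (M : R) : rlin rho ->
  (forall x, rho x <= M * rnorm x) ->
  exists lambda : dual V, forall x, toR (lambda x) = rho x.
Proof.
move=> rhoL rhoM.
have rhoM' x : `|rho x| <= M * rnorm x.
  by rewrite ler_norml lerNl -(rlinN rhoL) -{1}(rnormN x) !rhoM.
have [Kreal|[j jj jP]] := scalars_split R k.
  have bl : (fun x => ofR k (rho x) : K^o) \in @bounded_linear R k V K^o.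
    apply/asboolP; split=> [c x y|].
      by rewrite -{1}(Kreal c) rhoL ofRD ofRM Kreal.
    exists M => x; apply: le_trans (rhoM' x).
    by rewrite rnorm_ofR_norm.
  by exists (Bop bl) => x /=; rewrite ofRK.
have bl : (fun x => ofR k (rho x) + ofR k (rho (- j *: x)) * j : K^o)
    \in @bounded_linear R k V K^o.
  apply/asboolP; split=> [c x y|].
    have [_ /(_ c) cE] := jP 0.
    move: (toR c) (toR (- j * c)) cE => a b ->.
    have rhoE a' b' : rho ((ofR k a' + ofR k b' * j) *: x) =
                      a' * rho x + b' * rho (j *: x).
      by rewrite scalerDl -scalerA rhoL (rlinZ rhoL).
    have jcE : - j * (ofR k a + ofR k b * j) = ofR k b + ofR k (- a) * j.
      rewrite ofRN mulrDr addrC mulrCA mulNr jj opprK mulr1.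
      by rewrite mulrC mulNr mulrN.
    rewrite scalerDr scalerA jcE !(rlinD rhoL) !rhoE !scaleNr !(rlinN rhoL).
    rewrite -[_ *: (ofR k _ + _)]/(_ * _) !(ofRD, ofRM, ofRN).
    move: (ofR k a) (ofR k b) (ofR k (rho x)) (ofR k (rho (j *: x)))
          (ofR k (rho y)) (ofR k (rho (j *: y))) => a' b' p q r s.
    apply/eqP; rewrite -subr_eq0; apply/eqP.
    (* The two sides differ by a multiple of [1 + j * j], which vanishes. *)
    transitivity ((1 + j * j) * (b' * q)); last by rewrite jj subrr mul0r.
    by ring.
  exists (M + M * rnorm (j : K^o) * rnorm (j : K^o)) => x.
  rewrite (le_trans (rnormD _ _))// mulrDl lerD ?rnorm_ofR_norm// rnormM.
  rewrite rnorm_ofR_norm mulrAC ler_wpM2r ?rnorm_ge0//.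
  by rewrite (le_trans (rhoM' _))// rnormZ rnormN mulrA.
exists (Bop bl) => x /=.
by rewrite toRD ofRK (jP _).1 addr0.
Qed.

Definition real_dual (rho : V -> R) : Prop :=
  rlin rho /\ exists M : R, forall x, rho x <= M * rnorm x.

(* Phi acts on a bounded real functional rho as the real part of the value of
   Phi at the unique lambda in the dual of V whose real part is rho. *)
Definition bidual_real (Phi : bidual V) (rho : V -> R) : R :=
  toR (Phi (xget 0 [set lambda : dual V | forall x, toR (lambda x) = rho x])).

Lemma bidual_real_toR (Phi : bidual V) (lambda : dual V) :
  bidual_real Phi (fun x => toR (lambda x)) = toR (Phi lambda).
Proof.
rewrite /bidual_real; case: xgetP => [lambda' _ l'P|/(_ lambda)]; last by case.
by congr (toR (Phi _)); exact: dual_eq_toR.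
Qed.

Lemma bidual_realP (Phi : bidual V) r rho sigma :
  real_dual rho -> real_dual sigma ->
  bidual_real Phi (fun x => r * rho x + sigma x) =
  r * bidual_real Phi rho + bidual_real Phi sigma.
Proof.
move=> [rhoL [M rhoM]] [sigmaL [N sigmaN]].
have [lambda lE] := rlin_lift rhoL rhoM.
have [nu nE] := rlin_lift sigmaL sigmaN.
have -> : rho = (fun x => toR (lambda x)) by exact/funext.
have -> : sigma = (fun x => toR (nu x)) by exact/funext.
rewrite !bidual_real_toR -toRM -toRD.
rewrite -[X in toR X](linearP Phi) -bidual_real_toR.
by congr bidual_real; apply/funext => x; rewrite -toRM -toRD.
Qed.

Lemma bidual_real_le (Phi : bidual V) rho (M : R) : 0 <= M ->
  rlin rho -> (forall x, rho x <= M * rnorm x) ->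
  bidual_real Phi rho <= opnorm Phi * M.
Proof.
move=> M0 rhoL rhoM; have [lambda lE] := rlin_lift rhoL rhoM.
have -> : rho = (fun x => toR (lambda x)) by exact/funext.
rewrite bidual_real_toR (le_trans (toR_le_rnorm _))//.
rewrite (le_trans (opnorm_le _ _))//.
rewrite ler_wpM2l ?opnorm_ge0// rnorm_bopE opnorm_lub//.
by apply: rnorm_le_toR => // x; rewrite lE.
Qed.

End RealLinear.

(** * The Mazur-Orlicz theorem *)

Section MazurOrlicz.
Variables (R : realType) (k : scalar_kind).
Local Notation K := (scalars R k).
Variable V : lmodType K.

Definition sublinear (p : V -> R) : Prop :=
  (forall x y, p (x + y) <= p x + p y) /\
  (forall (r : R) (x : V), 0 < r -> p (ofR k r *: x) <= r * p x).

Lemma sublinear0 p : sublinear p -> p 0 = 0.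
Proof.
move=> [_ pZ]; apply/eqP; rewrite eq_le.
have h2 : 0 < 2^-1 :> R by rewrite invr_gt0.
have := pZ 2 0 (ltr0Sn _ 1); have := pZ _ 0 h2; rewrite !scaler0; lra.
Qed.

Lemma sublinear_lb p x : sublinear p -> - p (- x) <= p x.
Proof.
move=> ps; have := ps.1 x (- x); rewrite subrr (sublinear0 ps); lra.
Qed.

(** A pair [(v, c)] of the cone stands for the requirement [c <= L v] on a functional [L] to be
    constructed. *)
Definition cone (G : set (V * R)) : Prop :=
  [/\ G (0, 0),
      forall g h, G g -> G h -> G (g.1 + h.1, g.2 + h.2) &
      forall r g, 0 < r -> G g -> G (ofR k r *: g.1, r * g.2)].

(** Take for [q x] the infimum of [p (x + g.1) - g.2] over the cone, which [- p (- x)] bounds from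
    below. A linear functional below [q] meets every requirement of the cone, as evaluation at
    [- g.1] shows. *)
Lemma sublinear_cone p G : sublinear p -> cone G ->
  (forall g, G g -> g.2 <= p g.1) ->
  exists q, [/\ sublinear q, forall x, q x <= p x &
    forall x g, G g -> q x <= p (x + g.1) - g.2].
Proof.
move=> ps [G0 GD GZ] Gp.
pose S x := [set p (x + g.1) - g.2 | g in G].
have Slb x : has_lbound (S x).
  exists (- p (- x)) => _ [g Gg <-].
  have := ps.1 (x + g.1) (- x); rewrite addrAC subrr add0r => h.
  have := Gp _ Gg; lra.
have qle x g : G g -> inf (S x) <= p (x + g.1) - g.2.
  by move=> Gg; apply: ge_inf => //; exists g.
have S0 x : S x !=set0 by exists (p (x + 0) - 0), (0, 0).
exists (fun x => inf (S x)); split=> // [|x]; last first.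
  by have := qle x _ G0; rewrite addr0 subr0.
split=> [x y|r x r0].
  rewrite /= -lerBlDr; apply: lb_le_inf => // _ [g Gg <-].
  rewrite lerBlDr -lerBlDl; apply: lb_le_inf => // _ [h Gh <-].
  have := qle (x + y) _ (GD _ _ Gg Gh); rewrite /= addrACA.
  have := ps.1 (x + g.1) (y + h.1); lra.
rewrite mulrC -ler_pdivrMr//; apply: lb_le_inf => // _ [g Gg <-].
rewrite ler_pdivrMr//; have := qle (ofR k r *: x) _ (GZ _ _ r0 Gg).
rewrite /= -scalerDr; have := ps.2 r (x + g.1) r0; lra.
Qed.

(** Zorn's lemma, with the pointwise infimum as the bound of a chain. The infimum is subadditive
    because any two members of the chain are comparable. *)
Lemma sublinear_minimal p : sublinear p ->
  exists q, [/\ sublinear q, forall x, q x <= p x &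
    forall q', sublinear q' -> (forall x, q' x <= q x) -> q' = q].
Proof.
move=> ps.
pose T := {q : V -> R | sublinear q /\ forall x, q x <= p x}.
pose le (s t : T) := `[< forall x, sval t x <= sval s x >].
have [||A Atot|q qmax] := @ZL_preorder T (exist _ p (conj ps (fun=> lexx _))) le.
- by move=> t; apply/asboolP.
- move=> r s t /asboolP rs /asboolP st; apply/asboolP => x.
  exact: le_trans (st x) (rs x).
- have [->|/set0P[s0 As0]] := eqVneq A set0.
    by exists (exist _ p (conj ps (fun=> lexx _))).
  pose S x := [set sval s x | s in A].
  have Slb x : has_lbound (S x).
    exists (- p (- x)) => _ [s As <-]; have [ss sp] := svalP s.
    by apply: le_trans (sublinear_lb _ ss); rewrite lerN2.
  have S0 x : S x !=set0 by exists (sval s0 x), s0.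
  have qle x s : A s -> inf (S x) <= sval s x.
    by move=> As; apply: ge_inf => //; exists s.
  have qs : sublinear (fun x => inf (S x)).
    split=> [x y|r x r0].
      rewrite /= -lerBlDr; apply: lb_le_inf => // _ [s As <-].
      rewrite lerBlDr -lerBlDl; apply: lb_le_inf => // _ [t At <-].
      rewrite lerBlDl; have [[ss _] [ts _]] := (svalP s, svalP t).
      have [/asboolP st|/asboolP ts'] := Atot _ _ As At.
        apply: le_trans (qle _ _ At) (le_trans (ts.1 _ _) _).
        by rewrite lerD2r.
      apply: le_trans (qle _ _ As) (le_trans (ss.1 _ _) _).
      by rewrite lerD2l.
    rewrite /= mulrC -ler_pdivrMr//; apply: lb_le_inf => // _ [s As <-].
    rewrite ler_pdivrMr// mulrC; have [ss _] := svalP s.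
    exact: le_trans (qle _ _ As) (ss.2 _ _ r0).
  have qp x : inf (S x) <= p x.
    exact: le_trans (qle _ _ As0) ((svalP s0).2 x).
  exists (exist _ (fun x => inf (S x)) (conj qs qp) : T) => s As.
  by apply/asboolP => x; exact: qle.
- exists (sval q); have [qs qp] := svalP q; split=> // q' q's q'q.
  have q'p x : q' x <= p x by exact: le_trans (q'q x) (qp x).
  have := qmax (exist _ q' (conj q's q'p)); rewrite /le asboolT// => /(_ isT).
  move=> /asboolP /= qq'; apply/funext => x; apply/eqP.
  by rewrite eq_le q'q qq'.
Qed.

(* A minimal sublinear q is additive: x |-> inf_(t >= 0) (q (x + t y) - t q y) is
   sublinear and below q, hence equal to q, so that q x <= q (x + y) - q y. *)
Lemma mazur_orlicz p G : sublinear p -> cone G ->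
  (forall g, G g -> g.2 <= p g.1) ->
  exists L, [/\ rlin L, forall x, L x <= p x & forall g, G g -> g.2 <= L g.1].
Proof.
move=> ps Gc Gp; have [p' [p's p'p p'G]] := sublinear_cone ps Gc Gp.
have [q [qs qp' qmin]] := sublinear_minimal p's.
have q0 := sublinear0 qs.
have qZ r x : 0 < r -> q (ofR k r *: x) = r * q x.
  move=> r0; apply/eqP; rewrite eq_le qs.2//=.
  have := qs.2 r^-1 (ofR k r *: x); rewrite invr_gt0 => /(_ r0).
  by rewrite scalerA -ofRM mulVf ?gt_eqF// ofR1 scale1r mulrC ler_pdivlMr// mulrC.
have qD x y : q (x + y) = q x + q y.
  apply/eqP; rewrite eq_le qs.1 /=.
  pose H := [set g : V * R | exists2 t, 0 <= t & g = (ofR k t *: y, t * q y)].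
  have Hc : cone H.
    split; first by exists 0; rewrite // ofR0 scale0r mul0r.
      move=> _ _ [t t0 ->] [u u0 ->]; exists (t + u); first exact: addr_ge0.
      by rewrite ofRD scalerDl mulrDl.
    move=> r _ r0 [t t0 ->]; exists (r * t); first by rewrite mulr_ge0// ltW.
    by rewrite /= scalerA -ofRM mulrA.
  have [|q' [q's q'q q'H]] := sublinear_cone qs Hc.
    move=> _ [t t0 ->] /=; move: t0; rewrite le_eqVlt => /predU1P[<-|t0].
      by rewrite ofR0 scale0r mul0r q0.
    by rewrite qZ.
  have <- := qmin _ q's q'q; rewrite -lerBrDr (qmin _ q's q'q).
  have := q'H x (y, q y); rewrite (qmin _ q's q'q); apply.
  by exists 1; rewrite // ofR1 scale1r mul1r.
have qN x : q (- x) = - q x by apply: (addrI (q x)); rewrite -qD !subrr.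
exists q; split=> [r x y|x|g Gg].
- rewrite qD; congr (_ + _).
  have [r0|r0|->] := ltrgt0P r; [exact: qZ| |by rewrite mul0r ofR0 scale0r].
  by rewrite -[r]opprK ofRN scaleNr qN qZ ?oppr_gt0// !mulNr.
- exact: le_trans (qp' x) (p'p x).
- have := le_trans (qp' (- g.1)) (p'G (- g.1) _ Gg).
  by rewrite addNr (sublinear0 ps) qN sub0r lerN2.
Qed.

End MazurOrlicz.

Section NormingFunctional.
Variables (R : realType) (k : scalar_kind).
Local Notation K := (scalars R k).

(** The Mazur-Orlicz theorem for the norm and the ray through [(y, rnorm y)]. *)
Lemma norming_functional (V : normedModType K) (y : V) :
  exists2 f : dual V, opnorm f <= 1 & rnorm y <= toR (f y).
Proof.
pose G := [set g : V * R | exists2 t, 0 <= t & g = (ofR k t *: y, t * rnorm y)].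
have [||_ [t t0 ->] /=|L [LL Lle LG]] := @mazur_orlicz R k V (@rnorm R k V) G.
- by split=> [|r x r0]; [exact: rnormD|rewrite rnormZ rnorm_ofR// ltW].
- split; first by exists 0; rewrite // ofR0 scale0r mul0r.
    move=> _ _ [t t0 ->] [u u0 ->]; exists (t + u); first exact: addr_ge0.
    by rewrite ofRD scalerDl mulrDl.
  move=> r _ r0 [t t0 ->]; exists (r * t); first by rewrite mulr_ge0// ltW.
  by rewrite /= scalerA -ofRM mulrA.
- by rewrite rnormZ rnorm_ofR.
have [|f fL] := rlin_lift (M := 1) LL; first by move=> x; rewrite mul1r.
exists f.
  by rewrite opnorm_lub//; apply: rnorm_le_toR => // x; rewrite fL mul1r.
rewrite fL; apply: (LG (y, rnorm y)); exists 1 => //.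
by rewrite ofR1 scale1r mul1r.
Qed.

End NormingFunctional.

(** * Convex sets of functionals on a semi-inner product space *)

(** Evaluate at the minimizer [- b / c]. If [c = 0], a nonnegative affine function is constant, so
    [b = 0]. *)
Lemma quadratic_ge0_discr (R : realFieldType) (a b c : R) : 0 <= c ->
  (forall t, 0 <= a + 2 * b * t + c * t ^+ 2) -> b ^+ 2 <= a * c.
Proof.
move=> c0 q; have [c00|cn0] := eqVneq c 0.
  have [->|b0] := eqVneq b 0; first by rewrite c00 expr0n mulr0.
  have := q (- (a + 1) / (2 * b)); rewrite c00 mul0r addr0.
  have -> : 2 * b * (- (a + 1) / (2 * b)) = - (a + 1) by field.
  lra.
have := q (- b / c).
have -> : a + 2 * b * (- b / c) + c * (- b / c) ^+ 2 = (a * c - b ^+ 2) / c.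
  by field.
by rewrite pmulr_lge0 ?invr_gt0 ?lt_def ?cn0// subr_ge0.
Qed.

Lemma scalar0 (R : pzRingType) (V : lmodType R) (f : V -> R) :
  scalar f -> f 0 = 0.
Proof. by move=> /(_ (-1) 0 0); rewrite scaler0 addr0 mulN1r addNr. Qed.

Lemma scalar_opp (R : pzRingType) (V : lmodType R) (f : V -> R) :
  scalar f -> forall v, f (- v) = - f v.
Proof.
by move=> fs v; have := fs (-1) v 0; rewrite (scalar0 fs) !addr0 scaleN1r mulN1r.
Qed.

Section PreHilbert.
Variables (R : realType) (V : lmodType R) (B : V -> V -> R).

Definition psd_form : Prop :=
  [/\ forall v w, B v w = B w v, forall v, scalar (B v) & forall v, 0 <= B v v].

Definition form_norm (v : V) : R := Num.sqrt (B v v).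

Definition form_bounded (L : V -> R) (C : R) : Prop :=
  scalar L /\ forall w, `|L w| <= C * form_norm w.

Hypothesis Bpsd : psd_form.

Let Bsym v w : B v w = B w v. Proof. by case: Bpsd. Qed.
Let Bge0 v : 0 <= B v v. Proof. by case: Bpsd. Qed.
Let BP v r x y : B v (r *: x + y) = r * B v x + B v y.
Proof. by have [_ Bs _] := Bpsd; exact: Bs. Qed.
Let BZDr v x r y : B v (x + r *: y) = B v x + r * B v y.
Proof. by rewrite addrC BP addrC. Qed.
Let BZDl v x r y : B (x + r *: y) v = B x v + r * B y v.
Proof. by rewrite Bsym BZDr !(Bsym v). Qed.
Let Bsub v x y : B v (x - y) = B v x - B v y.
Proof. by rewrite -scaleN1r BZDr mulN1r. Qed.

Let BsubL v x y : B (x - y) v = B x v - B y v.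
Proof. by rewrite Bsym Bsub !(Bsym v). Qed.

Lemma form_norm_ge0 v : 0 <= form_norm v.
Proof. exact: sqrtr_ge0. Qed.

Lemma form_normN v : form_norm (- v) = form_norm v.
Proof.
have [_ Bs _] := Bpsd.
by rewrite /form_norm (scalar_opp (Bs _)) Bsym (scalar_opp (Bs _)) opprK.
Qed.

Lemma sqr_form_norm v : form_norm v ^+ 2 = B v v.
Proof. exact: sqr_sqrtr. Qed.

Lemma form_sqrD x y t :
  B (x + t *: y) (x + t *: y) = B x x + 2 * B x y * t + B y y * t ^+ 2.
Proof. by rewrite BZDl !BZDr (Bsym y x); ring. Qed.

Lemma form_cauchy_schwarz v w : `|B v w| <= form_norm v * form_norm w.
Proof.
rewrite -sqrtr_sqr -sqrtrM//; apply: ler_wsqrtr.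
apply: quadratic_ge0_discr => // t.
by rewrite -form_sqrD.
Qed.

(* V need not be complete, so L is only approximated by inner products: v is a
   near minimizer of B v v - 2 L v. *)
Lemma riesz_approx (L : V -> R) (C eta : R) : 0 < eta -> form_bounded L C ->
  exists v, forall w, `|B v w - L w| <= eta * form_norm w.
Proof.
move=> eta0 [Llin LC].
pose q v := B v v - 2 * L v; pose S := range q.
have S0 : has_inf S.
  split; first by exists (q 0), 0.
  exists (- C ^+ 2) => _ [v _ <-]; rewrite /q -sqr_form_norm.
  have /ler_normlP[_ h] := LC v.
  have := sqr_ge0 (form_norm v - C); rewrite sqrrB -mulr_natr; lra.
have [_ [v _ <-] vinf] := inf_adherent (exprn_gt0 2 eta0) S0.
exists v => w.
(* Minimality of [v] up to [eta ^+ 2] says that the quadratic in [t] with coefficients [eta ^+ 2],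
   [2 * (B v w - L w)] and [B w w] is nonnegative. *)
have := @quadratic_ge0_discr R (eta ^+ 2) (B v w - L w) (B w w) (Bge0 w).
move=> /(_ _) h.
rewrite -sqrtr_sqr -[eta]ger0_norm ?(ltW eta0)// -sqrtr_sqr -sqrtrM ?sqr_ge0//.
apply: ler_wsqrtr; apply: h => t.
have : inf S <= q (v + t *: w) by apply: ge_inf; [exact: S0.2|exists (v + t *: w)].
rewrite /q form_sqrD [v + _]addrC Llin; move: vinf; rewrite /q; lra.
Qed.

(* Mazur's theorem: a convex set D of functionals is as close to P in the dual
   norm as it is weakly. The difference w = p - v, with v a near minimizer of the
   distance to p among representatives of elements of D, almost separates p
   from D. *)
Lemma mazur_form (D : set (V -> R)) (P : V -> R) (C delta : R) :
  0 <= C -> 0 < delta ->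
  (forall d d' t, D d -> D d' -> 0 <= t <= 1 ->
     D (fun w => (1 - t) * d w + t * d' w)) ->
  (forall d, D d -> form_bounded d C) -> form_bounded P C ->
  (forall w c, (forall d, D d -> d w <= c) -> P w <= c) ->
  exists2 d, D d & forall w, `|d w - P w| <= delta * form_norm w.
Proof.
move=> C0 delta0 Dconv Dbd Pbd DP.
(* The 5 adds up [3 * eta] for the distance from [p] to [v] and one [eta] for each of the two
   approximate representations. *)
pose eta := Num.min 1 (delta / 5).
have eta0 : 0 < eta by rewrite lt_min ltr01 divr_gt0.
have eta1 : eta <= 1 by rewrite ge_min lexx.
have eta5 : 5 * eta <= delta.
  by rewrite mulrC -ler_pdivlMr// ge_min lexx orbT.
have [p pP] := riesz_approx eta0 Pbd.
pose E := [set v | exists2 d, D d & forall w, `|B v w - d w| <= eta * form_norm w].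
have Enorm v : E v -> form_norm v <= C + eta.
  move=> [d Dd vd]; have [//|nv] := leP (form_norm v) (C + eta).
  have := vd v; have := (Dbd _ Dd).2 v; rewrite -sqr_form_norm.
  move=> /ler_normlP[_ h1] /ler_normlP[_ h2].
  have v0 : 0 < form_norm v by apply: le_lt_trans nv; rewrite addr_ge0// ltW.
  have : (C + eta) * form_norm v < form_norm v * form_norm v by rewrite ltr_pM2r.
  lra.
have Econv v v' t : E v -> E v' -> 0 <= t <= 1 -> E (v + t *: (v' - v)).
  move=> [d Dd vd] [d' Dd' vd'] /andP[t0 t1].
  exists (fun w => (1 - t) * d w + t * d' w).
    by apply: Dconv => //; rewrite t0.
  move=> w; rewrite BZDl BsubL.
  have t1' : 0 <= 1 - t by rewrite subr_ge0.
  have /ler_normlP[a1 a2] := vd w; have /ler_normlP[b1 b2] := vd' w.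
  have := ler_wpM2l t1' a1; have := ler_wpM2l t1' a2.
  have := ler_wpM2l t0 b1; have := ler_wpM2l t0 b2.
  by move=> *; apply/ler_normlP; split; lra.
have [v0 Ev0] : E !=set0.
  have [d Dd] : exists d, D d.
    (* For empty [D], the hypothesis [DP] at [w = 0] would give [P 0 <= P 0 - 1]. *)
    apply: contrapT => nD; have := DP 0 (P 0 - 1).
    have h d : D d -> d 0 <= P 0 - 1 by move=> Dd; exfalso; apply: nD; exists d.
    by move=> /(_ h); lra.
  have [v vd] := riesz_approx eta0 (Dbd _ Dd).
  by exists v, d.
(* [L] bounds the distance between points of [E], and [eps] is the step to be taken from [v] towards
   [v'], with [eps * (1 + L ^+ 2) = eta ^+ 2]. *)
pose L := 2 * (C + eta); pose eps := eta ^+ 2 / (1 + L ^+ 2).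
have L0 : 0 < 1 + L ^+ 2 by rewrite ltr_pwDl// sqr_ge0.
have eps0 : 0 < eps by rewrite divr_gt0// exprn_gt0.
have eps1 : eps <= 1.
  rewrite ler_pdivrMr// mul1r (@le_trans _ _ 1) ?lerDl ?sqr_ge0//.
  by rewrite expr_le1// ltW.
pose S := [set B (p - v) (p - v) | v in E].
have S0 : has_inf S.
  by split; [exists (B (p - v0) (p - v0)), v0|exists 0 => _ [v _ <-]].
have [_ [v Ev <-] vinf] := inf_adherent (exprn_gt0 2 eps0) S0.
pose w := p - v.
have wE x : B w x = B p x - B v x by rewrite BsubL.
(* First-order condition at the near minimizer: a step [eps] towards [v'] lowers the squared
   distance to [p] by less than [eps ^+ 2]. *)
have wle v' : E v' -> B v' w <= B v w + eta ^+ 2.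
  move=> Ev'.
  have : inf S <= B (w + (- eps) *: (v' - v)) (w + (- eps) *: (v' - v)).
    apply: ge_inf; first exact: S0.2.
    exists (v + eps *: (v' - v)); first by apply: Econv => //; rewrite eps1 ltW.
    by rewrite /w opprD addrA scaleNr.
  rewrite form_sqrD; move: vinf; rewrite -/w => vinf Sle.
  have nn : B (v' - v) (v' - v) <= L ^+ 2.
    rewrite -[- v]scaleN1r form_sqrD -!sqr_form_norm.
    have nv := Enorm _ Ev; have nv' := Enorm _ Ev'.
    have /ler_normlP[cs _] := form_cauchy_schwarz v' v.
    have := ler_pM (form_norm_ge0 v) (form_norm_ge0 v) nv nv.
    have := ler_pM (form_norm_ge0 v') (form_norm_ge0 v') nv' nv'.
    have := ler_pM (form_norm_ge0 v') (form_norm_ge0 v) nv' nv.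
    rewrite /L; lra.
  have h : 2 * B w (v' - v) * eps <= eps ^+ 2 + eps ^+ 2 * L ^+ 2.
    have := ler_wpM2r (sqr_ge0 eps) nn; rewrite sqrrN mulrN in Sle; lra.
  have epsL : eps * (1 + L ^+ 2) = eta ^+ 2 by rewrite divfK// gt_eqF.
  have : 2 * B w (v' - v) <= eta ^+ 2 by rewrite -(ler_pM2r eps0) -epsL; lra.
  rewrite Bsub (Bsym v') (Bsym v); have := sqr_ge0 eta; lra.
(* The weak hypothesis enters here: the bound on [E] carries over to [D] up to [eta], hence to
   [P]. *)
have Pw : P w <= B v w + eta ^+ 2 + eta * form_norm w.
  apply: DP => d Dd; have [v' v'd] := riesz_approx eta0 (Dbd _ Dd).
  have := wle v'; have /ler_normlP[h1 h2] := v'd w.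
  have Ev' : E v' by exists d.
  move=> /(_ Ev'); lra.
have wn : form_norm w <= 3 * eta.
  have : form_norm w ^+ 2 <= eta ^+ 2 + 2 * eta * form_norm w.
    rewrite sqr_form_norm wE.
    by have /ler_normlP[h1 h2] := pP w; lra.
  have [//|wn] := leP (form_norm w) (3 * eta) => h.
  have : eta * (3 * eta) < eta * form_norm w by rewrite ltr_pM2l.
  have : (3 * eta) * form_norm w < form_norm w * form_norm w.
    by rewrite ltr_pM2r// (le_lt_trans _ wn)// mulr_ge0// ltW.
  have := sqr_ge0 eta; lra.
have [d Dd vd] := Ev; exists d => // u.
have := ler_wpM2r (form_norm_ge0 u) wn; have := ler_wpM2r (form_norm_ge0 u) eta5.
have := form_cauchy_schwarz w u; rewrite wE.
have := pP u; have := vd u.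
move=> /ler_normlP[a1 a2] /ler_normlP[b1 b2] /ler_normlP[c1 c2] h1 h2.
by apply/ler_normlP; split; lra.
Qed.

End PreHilbert.

(** * Goldstine approximation in the form norm *)

Section Pairings.
Variables (R : realType) (k : scalar_kind).
Local Notation K := (scalars R k).
Variables (X : normedModType K) (V : lmodType R) (B : V -> V -> R).
Hypothesis Bpsd : psd_form B.

Definition bounded_pairing (T : X -> V -> R) (L : R) : Prop :=
  [/\ forall a, scalar (T a), forall w, rlin (T^~ w) &
      forall a w, `|T a w| <= L * rnorm a * form_norm B w].

(** By homogeneity, the bound [c] on the ball of radius [M] gives [rho x <= c / M * rnorm x]. This
    is the weak closeness of [Phi] to the ball that Mazur's theorem needs. *)
Lemma bidual_real_ball (Phi : bidual X) (rho : X -> R) (M c : R) :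
  opnorm Phi <= M -> 0 < M -> rlin rho ->
  (forall a, rnorm a <= M -> rho a <= c) ->
  bidual_real Phi rho <= c.
Proof.
move=> PhiM M0 rhoL rhoc.
have c0 : 0 <= c by rewrite -(rlin0 rhoL) rhoc// rnorm0 ltW.
have cM : 0 <= c / M by rewrite divr_ge0// ltW.
have -> : c = M * (c / M) by rewrite mulrC divfK// gt_eqF.
apply: (@le_trans _ _ (opnorm Phi * (c / M))); last by rewrite ler_wpM2r.
apply: bidual_real_le => // x; have [x0|x0] := eqVneq (rnorm x) 0.
  by rewrite (rnorm0_eq0 x0) (rlin0 rhoL) mulr_ge0// rnorm_ge0.
have {}x0 : 0 < rnorm x by rewrite lt_def x0 rnorm_ge0.
rewrite mulrAC ler_pdivlMr// -ler_pdivrMr//.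
have Mx : 0 <= M / rnorm x by rewrite divr_ge0 ?ltW.
have := rhoc (ofR k (M / rnorm x) *: x).
rewrite rnormZ rnorm_ofR// divfK ?gt_eqF//.
by rewrite (rlinZ rhoL) lexx => /(_ isT) h; rewrite -mulrA mulrC.
Qed.

Lemma bounded_pairing_real_dual T L w : bounded_pairing T L -> real_dual (T^~ w).
Proof.
move=> [_ Tl TL]; split=> //; exists (L * form_norm B w) => a.
by rewrite mulrAC (le_trans (ler_norm _)).
Qed.

Lemma bidual_real_pairing (Phi : bidual X) T L : 0 <= L -> bounded_pairing T L ->
  form_bounded B (fun w => bidual_real Phi (T^~ w)) (opnorm Phi * L).
Proof.
move=> L0 TT; have [Ts Tl TL] := TT.
have fs : scalar (fun w => bidual_real Phi (T^~ w)).
  move=> r v w; rewrite -bidual_realP; [|exact: bounded_pairing_real_dual TT..].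
  by congr bidual_real; apply/funext => a; rewrite Ts.
have h u : bidual_real Phi (T^~ u) <= opnorm Phi * L * form_norm B u.
  rewrite -mulrA; apply: bidual_real_le => // [|x].
    by rewrite mulr_ge0// sqrtr_ge0.
  by rewrite mulrAC (le_trans (ler_norm _)).
split=> // w; rewrite ler_norml h andbT lerNl -(form_normN Bpsd) -(scalar_opp fs).
exact: h.
Qed.

End Pairings.

Section Goldstine.
Variables (R : realType) (k : scalar_kind).
Local Notation K := (scalars R k).
Variables (X : normedModType K) (V : lmodType R) (B : V -> V -> R).
Hypothesis Bpsd : psd_form B.

(* Mazur's theorem in the space V^n, on the convex set of the functionals
   w |-> \sum_j T j a (w j) for a in the ball. *)
Lemma goldstine_form (Phi : bidual X) (n : nat) (T : nat -> X -> V -> R)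
    (L M delta : R) : 0 <= L -> opnorm Phi <= M -> 0 < M -> 0 < delta ->
  (forall j, (j < n)%N -> bounded_pairing B (T j) L) ->
  exists2 a, rnorm a <= M & forall j, (j < n)%N -> forall w,
    `|T j a w - bidual_real Phi (T j ^~ w)| <= delta * form_norm B w.
Proof.
move=> L0 PhiM M0 delta0 Tb.
pose W := {ffun 'I_n -> V}.
pose BW (f g : W) : R := \sum_(j < n) B (f j) (g j).
have [Bsym Bs Bge0] := Bpsd.
have BWpsd : psd_form BW.
  split=> [f g|f r g h|f]; first by apply: eq_bigr.
    rewrite /BW mulr_sumr -big_split /=; apply: eq_bigr => j _.
    by rewrite !ffunE Bs.
  exact: sumr_ge0.
have coord_le (f : W) j : form_norm B (f j) <= form_norm BW f.
  apply: ler_wsqrtr; rewrite /BW (bigD1 j)//= lerDl; exact: sumr_ge0.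
pose tau (a : X) (f : W) : R := \sum_(j < n) T j a (f j).
have taus a : scalar (tau a).
  move=> r f g; rewrite /tau mulr_sumr -big_split /=; apply: eq_bigr => j _.
  by have [Ts _ _] := Tb j (ltn_ord j); rewrite !ffunE Ts.
have taul f : rlin (tau^~ f).
  move=> r x y; rewrite /tau mulr_sumr -big_split /=; apply: eq_bigr => j _.
  by have [_ Tl _] := Tb j (ltn_ord j); rewrite Tl.
have taub a f : `|tau a f| <= n%:R * L * rnorm a * form_norm BW f.
  apply: (le_trans (ler_norm_sum _ _ _)).
  have -> : n%:R * L * rnorm a * form_norm BW f =
            \sum_(j < n) L * rnorm a * form_norm BW f.
    by rewrite sumr_const card_ord -[RHS]mulr_natl !mulrA.
  apply: ler_sum => j _; have [_ _ TL] := Tb j (ltn_ord j).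
  by rewrite (le_trans (TL _ _))// ler_wpM2l// mulr_ge0// rnorm_ge0.
have nL : 0 <= n%:R * L by rewrite mulr_ge0.
pose D := [set tau a | a in [set a | rnorm a <= M]].
have := @mazur_form R W BW BWpsd D (fun f => bidual_real Phi (tau^~ f))
  (n%:R * L * M) delta _ delta0.
case=> [|_ _ t [a aM <-] [b bM <-] /andP[t0 t1]|_ [a /= aM <-]| |f c Dc|].
- by rewrite mulr_ge0// ltW.
- have t1' : 0 <= 1 - t by rewrite subr_ge0.
  exists (ofR k (1 - t) *: a + ofR k t *: b).
    rewrite /= (le_trans (rnormD _ _))// !rnormZ !rnorm_ofR//.
    have := ler_wpM2l t1' aM; have := ler_wpM2l t0 bM; lra.
  apply/funext => f; have := taul f (1 - t) a (ofR k t *: b).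
  by rewrite (rlinZ (taul f)) => ->.
- split=> // f; rewrite (le_trans (taub _ _))// ler_wpM2r ?sqrtr_ge0//.
  by rewrite ler_wpM2l.
- have := bidual_real_pairing BWpsd Phi nL (And3 taus taul taub).
  move=> [fs fb]; split=> // f; rewrite (le_trans (fb f))//.
  by rewrite ler_wpM2r ?sqrtr_ge0// mulrC ler_wpM2l.
- by apply: (bidual_real_ball PhiM M0 (taul f)) => a aM; apply: Dc; exists a.
move=> _ [a /= aM <-] atau; exists a => // j jn w.
(* With [w] in coordinate [j] and 0 elsewhere, the sum reduces to [T j] and the norm is that of
   [w]. *)
pose f : W := [ffun i => if i == Ordinal jn then w else 0].
have tauE b : tau b f = T j b w.
  rewrite /tau (bigD1 (Ordinal jn))//= big1 => [|i /negPf ij].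
    by rewrite ffunE eqxx addr0.
  have [Ts _ _] := Tb i (ltn_ord i); rewrite ffunE ij.
  exact: scalar0.
have -> : form_norm B w = form_norm BW f.
  rewrite /form_norm /BW (bigD1 (Ordinal jn))//= big1 => [|i /negPf ij].
    by rewrite ffunE eqxx addr0.
  by rewrite ffunE ij (scalar0 (Bs _)).
have := atau f; rewrite tauE.
by have -> : tau^~ f = T j ^~ w by apply/funext => b; exact: tauE.
Qed.

End Goldstine.

(** * Sequences realizing both iterated limits *)

Section DoubleLimit.
Variables (R : realType) (k : scalar_kind).
Local Notation K := (scalars R k).
Variables (X : normedModType K) (V : lmodType R) (B : V -> V -> R).
Hypothesis Bpsd : psd_form B.

Definition rbilinear (h : X -> X -> V) : Prop :=
  (forall r a a' b, h (ofR k r *: a + a') b = r *: h a b + h a' b) /\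
  (forall r a b b', h a (ofR k r *: b + b') = r *: h a b + h a b').

Definition form_bounded2 (h : X -> X -> V) (L : R) : Prop :=
  forall a b, form_norm B (h a b) <= L * rnorm a * rnorm b.

Lemma rbilinear_pairing h L b : rbilinear h -> form_bounded2 h L ->
  bounded_pairing B (fun a => B (h a b)) (L * rnorm b).
Proof.
move=> [hl _] hL; have [Bsym Bs Bge0] := Bpsd; split=> [a|w r x y|a w].
- exact: Bs.
- by rewrite hl ![B _ w]Bsym Bs.
- rewrite (le_trans (form_cauchy_schwarz Bpsd _ _))// ler_wpM2r ?sqrtr_ge0//.
  by rewrite mulrAC.
Qed.

Lemma rbilinear_flip h : rbilinear h -> rbilinear (fun a b => h b a).
Proof. by move=> [hl hr]; split=> [r a a' b|r a b b']; [exact: hr|exact: hl]. Qed.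

Lemma form_bounded2_flip h L :
  form_bounded2 h L -> form_bounded2 (fun a b => h b a) L.
Proof. by move=> hL a b; rewrite mulrAC. Qed.

(** Applying [Psi] in the second variable leaves a bounded pairing in the first, so [goldstine_form]
    also approximates iterated values. *)
Lemma bidual_pairing h L (Psi : bidual X) :
  0 <= L -> rbilinear h -> form_bounded2 h L ->
  bounded_pairing B (fun a w => bidual_real Psi (fun b => B (h a b) w))
    (opnorm Psi * L).
Proof.
move=> L0 hb hL; have [hl hr] := hb.
have flip a := rbilinear_pairing a (rbilinear_flip hb) (form_bounded2_flip hL).
have Lr0 (a : X) : 0 <= L * rnorm a by rewrite mulr_ge0// rnorm_ge0.
have [Bsym Bs Bge0] := Bpsd; split=> [a|w r x y|a w].
- by have [] := bidual_real_pairing Bpsd Psi (Lr0 a) (flip a).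
- rewrite -bidual_realP; [|exact: bounded_pairing_real_dual (flip _)..].
  by congr bidual_real; apply/funext => b; rewrite hl ![B _ w]Bsym Bs.
- have [_ /(_ w)] := bidual_real_pairing Bpsd Psi (Lr0 a) (flip a).
  by rewrite mulrA.
Qed.

(** One use of [goldstine_form] on [n.+1] pairings: number 0 has [Psi] applied in the second
    variable, number [j.+1] has that variable frozen at [b j]. *)
Lemma double_limit_step h L M delta (Phi Psi : bidual X) n (b : nat -> X) :
  0 <= L -> rbilinear h -> form_bounded2 h L ->
  opnorm Phi <= M -> opnorm Psi <= M -> 0 < M -> 0 < delta ->
  (forall j, rnorm (b j) <= M) ->
  exists a, [/\ rnorm a <= M,
    forall w, `|bidual_real Psi (fun b => B (h a b) w) -
      bidual_real Phi (fun a => bidual_real Psi (fun b => B (h a b) w))|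
      <= delta * form_norm B w &
    forall j, (j < n)%N -> forall w, `|B (h a (b j)) w -
      bidual_real Phi (fun a => B (h a (b j)) w)| <= delta * form_norm B w].
Proof.
move=> L0 hb hL PhiM PsiM M0 delta0 bM.
pose T j := if j is j'.+1 then fun a => B (h a (b j'))
            else fun a w => bidual_real Psi (fun b => B (h a b) w).
have mono S (N N' : R) : N <= N' ->
    bounded_pairing B S N -> bounded_pairing B S N'.
  move=> NN [Ss Sl SN]; split=> // a w; rewrite (le_trans (SN a w))//.
  by rewrite ler_wpM2r ?sqrtr_ge0// ler_wpM2r ?rnorm_ge0.
have [||a aM aT] := @goldstine_form R k X V B Bpsd Phi n.+1 T (L * M) M delta
  _ PhiM M0 delta0; first by rewrite mulr_ge0// ltW.
- case=> [_|j _].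
    by apply: mono (bidual_pairing Psi L0 hb hL); rewrite mulrC ler_wpM2l.
  by apply: mono (rbilinear_pairing (b j) hb hL); rewrite ler_wpM2l.
- by exists a; split=> // [|j jn]; [exact: (aT 0%N)|exact: (aT j.+1)].
Qed.

(* a (m) is chosen after b 0, ..., b (m - 1), and b (n) after a 0, ..., a n, so
   that B (h (a m) (b n)) is close to the limit taken first in the index that was
   chosen last. *)
Lemma double_limit_sequences h L M delta (Phi Psi : bidual X) N :
  0 <= L -> rbilinear h -> form_bounded2 h L ->
  opnorm Phi <= M -> opnorm Psi <= M -> 0 < M -> 0 < delta ->
  exists a b : nat -> X,
  [/\ forall n, rnorm (a n) <= M, forall n, rnorm (b n) <= M,
    forall m n, (m <= n < N)%N -> forall w, `|B (h (a m) (b n)) w -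
      bidual_real Phi (fun a => bidual_real Psi (fun b => B (h a b) w))|
      <= delta * form_norm B w &
    forall m n, (n < m < N)%N -> forall w, `|B (h (a m) (b n)) w -
      bidual_real Psi (fun b => bidual_real Phi (fun a => B (h a b) w))|
      <= delta * form_norm B w].
Proof.
move=> L0 hb hL PhiM PsiM M0 delta0.
pose d := delta / 2; have d0 : 0 < d by rewrite divr_gt0.
pose P w := bidual_real Phi (fun a => bidual_real Psi (fun b => B (h a b) w)).
pose Q w := bidual_real Psi (fun b => bidual_real Phi (fun a => B (h a b) w)).
pose hPsi a w := bidual_real Psi (fun b => B (h a b) w).
pose hPhi b w := bidual_real Phi (fun a => B (h a b) w).
have close (F G H : V -> R) :
    (forall w, `|F w - G w| <= d * form_norm B w) ->
    (forall w, `|G w - H w| <= d * form_norm B w) ->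
    forall w, `|F w - H w| <= delta * form_norm B w.
  move=> FG GH w; have -> : F w - H w = (F w - G w) + (G w - H w) by ring.
  rewrite (le_trans (ler_normD _ _))// (le_trans (lerD (FG w) (GH w)))//.
  by rewrite -mulrDl /d -splitr.
(* The induction passes through the intermediate functionals [hPsi (a m)] and [hPhi (b n)]; each of
   the two stages costs [d], half of [delta]. *)
suff [a [b [aM bM aP bQ [ab ba]]]] : exists a b : nat -> X,
  [/\ forall n, rnorm (a n) <= M, forall n, rnorm (b n) <= M,
    forall m, (m < N)%N -> forall w, `|hPsi (a m) w - P w| <= d * form_norm B w,
    forall n, (n < N)%N -> forall w, `|hPhi (b n) w - Q w| <= d * form_norm B w &
    (forall m n, (m <= n < N)%N -> forall w,
      `|B (h (a m) (b n)) w - hPsi (a m) w| <= d * form_norm B w) /\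
    (forall m n, (n < m < N)%N -> forall w,
      `|B (h (a m) (b n)) w - hPhi (b n) w| <= d * form_norm B w)].
  exists a, b; split=> // m n mn; apply: close.
  - exact: ab.
  - by apply: aP; case/andP: mn; exact: leq_ltn_trans.
  - exact: ba.
  - by apply: bQ; case/andP: mn; exact: ltn_trans.
elim: N => [|N [a [b [aM bM aP bQ [ab ba]]]]].
  exists (fun=> 0), (fun=> 0); split=> // [n|n|]; try by rewrite rnorm0 ltW.
  by split=> m n; rewrite ltn0 andbF.
have [x [xM xP xb]] :=
  double_limit_step N L0 hb hL PhiM PsiM M0 d0 bM.
pose a' m := if m == N then x else a m.
have a'M m : rnorm (a' m) <= M by rewrite /a'; case: ifP.
have [y [yM yQ ya]] := double_limit_step N.+1 L0 (rbilinear_flip hb)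
  (form_bounded2_flip hL) PsiM PhiM M0 d0 a'M.
exists a', (fun n => if n == N then y else b n); split=> //.
- by move=> n; case: ifP.
- move=> m; rewrite ltnS leq_eqVlt /a'; case: eqVneq => [_ _|_ /= mN].
    exact: xP.
  exact: aP.
- move=> n; rewrite ltnS leq_eqVlt; case: eqVneq => [_ _|_ /= nN].
    exact: yQ.
  exact: bQ.
- split=> m n.
    rewrite ltnS [(n <= N)%N]leq_eqVlt; case: eqVneq => [->|_] /andP[mn /= nN].
      by apply: ya; rewrite ltnS.
    rewrite /a' ltn_eqF ?(leq_ltn_trans mn)//; apply: ab; exact/andP.
  rewrite ltnS [(m <= N)%N]leq_eqVlt => /andP[nm]; rewrite /a'.
  case: eqVneq nm => [->|_] nm /= mN; first by rewrite ltn_eqF//; exact: xb.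
  by rewrite ltn_eqF ?(ltn_trans nm)//; apply: ba; exact/andP.
Qed.

End DoubleLimit.

(** * Positive functionals on bounded functions *)

Section BoundedFunctions.
Variables (R : realType) (T : Type).

Definition bounded_fun : {pred T -> R^o} :=
  fun f => `[< exists M : R, forall x, `|f x| <= M >].

Record bfun := BFun { bfun_val :> T -> R^o ; _ : bfun_val \in bounded_fun }.

HB.instance Definition _ := [isSub for bfun_val].
HB.instance Definition _ := [Choice of bfun by <:].

Lemma bounded_fun_submod : submod_closed bounded_fun.
Proof.
split=> [|a f g /asboolP[M fM] /asboolP[N gN]]; apply/asboolP.
  by exists 0 => x; rewrite normr0.
exists (`|a| * M + N) => x; rewrite (le_trans (ler_normD _ _))// lerD//.
by rewrite normrM ler_wpM2l.
Qed.

HB.instance Definition _ :=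
  GRing.isSubmodClosed.Build R (T -> R^o) bounded_fun bounded_fun_submod.
HB.instance Definition _ := [SubChoice_isSubLmodule of bfun by <:].

Lemma bfunP (f g : bfun) : f =1 g -> f = g.
Proof. by move=> fg; apply/val_inj/funext. Qed.

Lemma bfun_bounded (f : bfun) : exists2 M : R, 0 <= M & forall x, `|f x| <= M.
Proof.
case: f => f /= /asboolP[M fM]; exists `|M| => // x.
by rewrite (le_trans (fM x)) ?ler_norm.
Qed.

Lemma bounded_fun_mul (f g : bfun) : (fun x => f x * g x) \in bounded_fun.
Proof.
have [M M0 fM] := bfun_bounded f; have [N N0 gN] := bfun_bounded g.
by apply/asboolP; exists (M * N) => x; rewrite normrM ler_pM.
Qed.

Definition bmul f g := BFun (bounded_fun_mul f g).

Lemma bounded_fun_cst (r : R) : (fun=> r) \in bounded_fun.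
Proof. by apply/asboolP; exists `|r|. Qed.

Definition bcst r := BFun (bounded_fun_cst r).

Lemma bfun_sumE (I : finType) (F : I -> bfun) x :
  (\sum_i F i) x = \sum_i F i x.
Proof. by rewrite (big_morph (fun f : bfun => f x) (id1 := 0) (op1 := +%R)). Qed.

(** A positive functional of total mass [M]: [t = 0] gives positivity, and the constants 1 and -1
    give the mass. *)
Definition mean_bound (nu : bfun -> R) (M : R) : Prop :=
  scalar nu /\ forall (f : bfun) (t : R), (forall x, f x <= t) -> nu f <= M * t.

Definition mean_form (nu : bfun -> R) (f g : bfun) : R := nu (bmul f g).

Section Mean.
Variables (nu : bfun -> R) (M : R).
Hypotheses (nuM : mean_bound nu M) (M0 : 0 <= M).

Let nuP r f g : nu (r *: f + g) = r * nu f + nu g.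
Proof. by case: nuM => ns _; rewrite ns. Qed.
Let nu0 : nu 0 = 0. Proof. by case: nuM => /scalar0. Qed.
Let nuZ r f : nu (r *: f) = r * nu f.
Proof. by rewrite -[r *: f]addr0 nuP nu0 addr0. Qed.
Let nuD f g : nu (f + g) = nu f + nu g.
Proof. by rewrite -{1}[f]scale1r nuP mul1r. Qed.
Let nuB f g : nu (f - g) = nu f - nu g.
Proof. by rewrite -scaleN1r nuD nuZ mulN1r. Qed.

Lemma mean_ge0 (f : bfun) : (forall x, 0 <= f x) -> 0 <= nu f.
Proof.
move=> f0; have [ns nM] := nuM; rewrite -oppr_le0 -(scalar_opp ns).
by rewrite -(mulr0 M) nM// => x; rewrite oppr_le0.
Qed.

Lemma mean_form_psd : psd_form (mean_form nu).
Proof.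
split=> [f g|f r g h|f].
- by congr nu; apply: bfunP => x /=; rewrite mulrC.
- rewrite /mean_form -nuP; congr nu; apply: bfunP => x /=.
  by rewrite mulrDr mulrCA.
- by apply: mean_ge0 => x /=; rewrite -expr2 sqr_ge0.
Qed.

Lemma mean_form_norm (f : bfun) (s : R) : 0 <= s -> (forall x, `|f x| <= s) ->
  form_norm (mean_form nu) f <= Num.sqrt M * s.
Proof.
move=> s0 fs; rewrite -[s in leRHS]ger0_norm// -sqrtr_sqr -sqrtrM//.
apply: ler_wsqrtr; apply: nuM.2 => x /=.
by rewrite -expr2 -real_normK ?num_real// ler_pXn2r ?nnegrE.
Qed.

(* S is the sum of the squared deviations of all u m n from u 0 0 (if m <= n) or
   from u 1 0 (if n < m). Without the required point x,
   u 0 0 - u 1 0 - C S <= 3 eps everywhere, but its nu-value is too large. *)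
Lemma mean_order_pattern (H g : R) (N : nat) : 0 <= H -> 0 < g ->
  exists2 delta, 0 < delta &
  forall (u : nat -> nat -> bfun) (P Q : bfun -> R),
  (forall m n x, `|u m n x| <= H) -> g <= P (bcst 1) - Q (bcst 1) ->
  (forall m n, (m <= n < N.+2)%N -> forall w,
    `|mean_form nu (u m n) w - P w| <= delta * form_norm (mean_form nu) w) ->
  (forall m n, (n < m < N.+2)%N -> forall w,
    `|mean_form nu (u m n) w - Q w| <= delta * form_norm (mean_form nu) w) ->
  exists x, forall m n m' n', (m <= n < N.+2)%N -> (n' < m' < N.+2)%N ->
    u m' n' x + g / (8 * (M + 1)) <= u m n x.
Proof.
move=> H0 g0.
have M1 : 0 < M + 1 by rewrite ltr_wpDl.
pose eps := g / (8 * (M + 1)).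
have eps0 : 0 < eps by rewrite divr_gt0// mulr_gt0.
(* Once [S x >= eps ^+ 2], the penalty [C * S x] is at least [2 * H] and outweighs the difference of
   any two values of the [u m n]. *)
pose C := 2 * H / eps ^+ 2.
have C0 : 0 <= C by rewrite divr_ge0 ?sqr_ge0// mulr_ge0.
pose D : R := C * (N.+2 ^ 2)%:R * 4.
have D0 : 0 <= D by rewrite mulr_ge0 ?ler0n// mulr_ge0 ?ler0n.
pose n1 := form_norm (mean_form nu) (bcst 1).
have n10 : 0 <= n1 by exact: sqrtr_ge0.
(* The errors [2 * delta * n1] and [D * delta] together stay below [g / 4], while [3 * M * eps] is
   below [3 * g / 8]; so the final comparison is contradictory. *)
pose delta := Num.min 1 (g / (8 * (n1 + 1 + D))).
have den0 : 0 < 8 * (n1 + 1 + D) by lra.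
have delta0 : 0 < delta by rewrite lt_min ltr01 divr_gt0.
have delta1 : delta <= 1 by rewrite ge_min lexx.
have deltag : delta * (8 * (n1 + 1 + D)) <= g.
  by rewrite -ler_pdivlMr// ge_min lexx orbT.
have Bpsd := mean_form_psd.
exists delta => // u P Q uH gPQ uP uQ.
have form1 f : mean_form nu f (bcst 1) = nu f.
  by congr nu; apply: bfunP => x /=; rewrite mulr1.
(* The range [N.+2] contains the indices 0 and 1, so both reference pairs are admissible. *)
pose c m n : bfun := if (m <= n)%N then u 0%N 0%N else u 1%N 0%N.
have near_c m n : (m < N.+2)%N -> (n < N.+2)%N ->
    nu (bmul (u m n - c m n) (u m n - c m n)) <= 4 * delta.
  move=> mN nN; set z := u m n - c m n; pose L := if (m <= n)%N then P else Q.
  have h1 : `|mean_form nu (u m n) z - L z| <= delta * form_norm (mean_form nu) z.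
    rewrite /L; case: leqP => mn; [apply: uP|apply: uQ].
      by rewrite mn.
    by rewrite mn.
  have h2 : `|mean_form nu (c m n) z - L z| <= delta * form_norm (mean_form nu) z.
    by rewrite /L /c; case: leqP => mn; [exact: uP|exact: uQ].
  have zE : mean_form nu z z = mean_form nu (u m n) z - mean_form nu (c m n) z.
    by rewrite /mean_form -nuB; congr nu; apply: bfunP => x /=; rewrite mulrBl.
  rewrite -/(mean_form nu z z) -(sqr_form_norm Bpsd).
  have sz : form_norm (mean_form nu) z ^+ 2 <=
            2 * delta * form_norm (mean_form nu) z.
    move: h1 h2; rewrite (sqr_form_norm Bpsd) zE.
    by move=> /ler_normlP[a1 a2] /ler_normlP[b1 b2]; lra.
  have z2 : form_norm (mean_form nu) z <= 2 * delta.
    have [//|zlt] := leP (form_norm (mean_form nu) z) (2 * delta).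
    have z0 : 0 < form_norm (mean_form nu) z.
      by rewrite (lt_trans _ zlt)// mulr_gt0.
    have : 2 * delta * form_norm (mean_form nu) z <
           form_norm (mean_form nu) z ^+ 2.
      by rewrite expr2 ltr_pM2r.
    lra.
  have := ler_wpM2l (ltW delta0) z2; have := ler_wpM2l (ltW delta0) delta1; lra.
apply: contrapT => nx.
pose S : bfun := \sum_(p : 'I_N.+2 * 'I_N.+2)
  bmul (u p.1 p.2 - c p.1 p.2) (u p.1 p.2 - c p.1 p.2).
have nuS : nu S <= (N.+2 ^ 2)%:R * (4 * delta).
  rewrite /S (big_morph nu (id1 := 0) (op1 := +%R))//.
  have -> : (N.+2 ^ 2)%:R * (4 * delta) = \sum_(p : 'I_N.+2 * 'I_N.+2) (4 * delta).
    by rewrite sumr_const card_prod card_ord mulnn mulr_natl.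
  by apply: ler_sum => -[m n] _; exact: near_c.
have Sge x m n : (m < N.+2)%N -> (n < N.+2)%N -> (u m n x - c m n x) ^+ 2 <= S x.
  move=> mN nN; rewrite /S bfun_sumE (bigD1 (Ordinal mN, Ordinal nN))//= expr2.
  by rewrite lerDl sumr_ge0// => p _; rewrite -expr2 sqr_ge0.
have Sge0 x : 0 <= S x.
  by apply: le_trans (Sge x 0%N 0%N _ _) => //; exact: sqr_ge0.
have ptw x : (u 0%N 0%N - u 1%N 0%N - C *: S) x <= 3 * eps.
  rewrite -[leLHS]/(u 0%N 0%N x - u 1%N 0%N x - C * S x).
  have [m [n [m' [n' [mn mn' lt]]]]] : exists m n m' n',
      [/\ (m <= n < N.+2)%N, (n' < m' < N.+2)%N & u m n x < u m' n' x + eps].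
    apply: contrapT => h; apply: nx; exists x => m n m' n' mn mn'.
    rewrite leNgt; apply/negP => lt; apply: h; exists m, n, m', n'; split=> //.
  have /andP[mn1 nN] := mn; have mN := leq_ltn_trans mn1 nN.
  have /andP[mn1' mN'] := mn'; have nN' := ltn_trans mn1' mN'.
  have s1 := Sge x _ _ mN nN; have s2 := Sge x _ _ mN' nN'.
  have cE : c m n = u 0%N 0%N by rewrite /c mn1.
  have cE' : c m' n' = u 1%N 0%N by rewrite /c leqNgt mn1'.
  rewrite cE in s1; rewrite cE' in s2.
  have big : eps ^+ 2 <= S x -> u 0%N 0%N x - u 1%N 0%N x - C * S x <= 3 * eps.
    move=> eS; have := ler_wpM2l C0 eS; rewrite divfK ?gt_eqF ?exprn_gt0//.
    have /ler_normlP[_ a] := uH 0%N 0%N x; have /ler_normlP[b _] := uH 1%N 0%N x.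
    lra.
  (* Either some deviation exceeds [eps] and the penalty takes over, or both values are within [eps]
     of their references and the violated order yields [3 * eps]. *)
  have [e1|e1] := leP `|u m n x - u 0%N 0%N x| eps; last first.
    apply: big; apply: le_trans s1; rewrite -[leRHS]real_normK ?num_real//.
    by rewrite ler_pXn2r ?nnegrE ?normr_ge0 ?ltW.
  have [e2|e2] := leP `|u m' n' x - u 1%N 0%N x| eps; last first.
    apply: big; apply: le_trans s2; rewrite -[leRHS]real_normK ?num_real//.
    by rewrite ler_pXn2r ?nnegrE ?normr_ge0 ?ltW.
  move: e1 e2 => /ler_normlP[a1 a2] /ler_normlP[b1 b2].
  have := mulr_ge0 C0 (Sge0 x); lra.
have := nuM.2 _ _ ptw; rewrite nuB nuB nuZ.
have /ler_normlP[p1 _] := uP 0%N 0%N isT (bcst 1).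
have /ler_normlP[_ q1] := uQ 1%N 0%N isT (bcst 1).
rewrite !form1 -/n1 in p1 q1.
have epsE : 8 * (M + 1) * eps = g by rewrite mulrC divfK// gt_eqF// mulr_gt0.
have := ler_wpM2l C0 nuS.
have : C * ((N.+2 ^ 2)%:R * (4 * delta)) = D * delta by rewrite /D; ring.
have := mulr_ge0 M0 (ltW eps0).
have := mulr_ge0 n10 (ltW delta0); have := mulr_ge0 D0 (ltW delta0).
lra.
Qed.

End Mean.
End BoundedFunctions.

(** * Extension of a functional to a positive mean *)

Section MeanExtension.
Variables (R : realType) (k : scalar_kind) (T : Type) (t0 : T).
Local Notation K := (scalars R k).

(** The Mazur-Orlicz theorem over the reals for [M * sup f], the cone being the set of pairs
    [(h a, rho a)]. This cone is closed under negation, so its requirements become equalities. The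
    point [t0] keeps the suprema over nonempty sets. *)
Lemma mean_extension (X : lmodType K) (h : X -> bfun R T) (rho : X -> R) (M : R) :
  0 <= M ->
  (forall r a b, h (ofR k r *: a + b) = r *: h a + h b) -> rlin rho ->
  (forall a t, (forall x, h a x <= t) -> rho a <= M * t) ->
  exists2 nu, mean_bound nu M & forall a, nu (h a) = rho a.
Proof.
move=> M0 hL rhoL rhoM.
have hs (f : bfun R T) : has_sup (range f).
  split; first by exists (f t0), t0.
  have [N N0 fN] := bfun_bounded f; exists N => _ [x _ <-].
  exact: le_trans (ler_norm _) (fN x).
have sup_ub (f : bfun R T) x : f x <= sup (range f).
  by apply: ub_le_sup; [exact: (hs f).2|exists x].
pose p (f : bfun R T) := M * sup (range f).
pose G := [set g : bfun R T * R | exists a, g = (h a, rho a)].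
have h0 : h 0 = 0.
  by have := hL (-1) 0 0; rewrite scaler0 addr0 scaleN1r addNr.
have hN a : h (- a) = - h a.
  by have := hL (-1) a 0; rewrite h0 !addr0 ofRN ofR1 !scaleN1r.
have [||_ [a ->] /=|nu [nuL nup nuG]] :=
  @mazur_orlicz R RealScalars (bfun R T) p G.
- split=> [f g|r f r0]; rewrite /p -?mulrDr 1?mulrCA ler_wpM2l//.
    apply: ge_sup; first by exists ((f + g) t0), t0.
    by move=> _ [x _ <-]; rewrite -[leLHS]/(f x + g x) lerD.
  apply: ge_sup; first by exists ((r *: f) t0), t0.
  by move=> _ [x _ <-]; rewrite -[leLHS]/(r * f x) ler_wpM2l// ltW.
- split; first by exists 0; rewrite h0 (rlin0 rhoL).
    move=> _ _ [a ->] [b ->]; exists (a + b); have := hL 1 a b.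
    by rewrite ofR1 !scale1r (rlinD rhoL) => ->.
  move=> r _ r0 [a ->]; exists (ofR k r *: a); have := hL r a 0.
  by rewrite h0 !addr0 (rlinZ rhoL) => ->.
- exact: rhoM.
exists nu.
  split=> [r f g|f t ft]; first exact: (nuL r f g).
  apply: le_trans (nup f) _; rewrite ler_wpM2l// ge_sup//.
    by exists (f t0), t0.
  by move=> _ [x _ <-].
have le a : rho a <= nu (h a) by apply: (nuG (h a, rho a)); exists a.
move=> a; apply/eqP; rewrite eq_le le andbT.
by have := le (- a); rewrite hN (rlinN rhoL) (rlinN nuL) lerN2.
Qed.

End MeanExtension.

(** * Ultraproducts of functionals *)

Section UltraLimits.
Variables (R : realType) (I : Type) (U : set_system I).
Context {UU : UltraFilter U}.

(** The image ultrafilter contains the compact interval from [- M] to [M]. *)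
Lemma ultra_cvg (f : I -> R) (M : R) :
  (forall i, `|f i| <= M) -> cvg (f i @[i --> U]).
Proof.
move=> fM.
have Uf : UltraFilter (f @ U).
  split=> [|G PG UG]; first exact: fmap_proper_filter.
  apply/seteqP; split=> // S GS.
  have [//|nS] := in_ultra_setVsetC (f @^-1` S) UU.
  have : G (S `&` ~` S) by apply: filterI => //; exact: UG.
  by rewrite setICr => /(filter_not_empty_ex (@filter_ex _ G _))[].
have Ub : (f @ U) `[- M, M]%classic.
  by apply: (@filterE _ U) => i /=; rewrite in_itv /= -ler_norml.
have := @segment_compact R (- M) M; rewrite compact_ultra => /(_ _ Uf Ub)[l [_ fl]].
by apply/cvg_ex; exists l.
Qed.

Lemma ultra_lim_le (f : I -> R) (M c : R) : (forall i, `|f i| <= M) ->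
  (\forall i \near U, f i <= c) -> lim (f i @[i --> U]) <= c.
Proof. by move=> fM; apply: limr_le; exact: ultra_cvg fM. Qed.

Lemma ultra_lim_ge (f : I -> R) (M c : R) : (forall i, `|f i| <= M) ->
  (\forall i \near U, c <= f i) -> c <= lim (f i @[i --> U]).
Proof. by move=> fM; apply: limr_ge; exact: ultra_cvg fM. Qed.

Lemma ultra_limP (r : R) (f g : I -> R) (M N : R) :
  (forall i, `|f i| <= M) -> (forall i, `|g i| <= N) ->
  lim (r * f i + g i @[i --> U]) =
  r * lim (f i @[i --> U]) + lim (g i @[i --> U]).
Proof.
move=> fM gN; apply/cvg_lim; first exact: Rhausdorff.
apply: cvgD; last exact: ultra_cvg gN.
by apply: cvgMr; exact: ultra_cvg fM.
Qed.

End UltraLimits.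

Section UltraFunctionals.
Variables (R : realType) (k : scalar_kind) (I : Type) (U : set_system I).
Context {UU : UltraFilter U}.
Local Notation K := (scalars R k).
Variables (V : normedModType K) (phi : I -> dual V) (L : R).
Hypothesis phiL : forall i, opnorm (phi i) <= L.

Definition ultra_functional (v : ultrapower U V) : R :=
  lim (toR (phi i (urepr v i)) @[i --> U]).

Let phi_le i x : `|toR (phi i x)| <= L * rnorm x.
Proof.
rewrite (le_trans (normr_toR _))// (le_trans (opnorm_le _ _))//.
by rewrite ler_wpM2r ?rnorm_ge0.
Qed.

Lemma ultra_functional_bound (x : linfty I V) :
  exists M, forall i, `|toR (phi i (x i))| <= M.
Proof.
have [N N0 xN] := linfty_bounded x; exists (`|L| * N) => i.
rewrite (le_trans (phi_le _ _))// (le_trans (ler_norm _))// normrM ler_wpM2l//.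
by rewrite ger0_norm ?rnorm_ge0.
Qed.

(** Two representatives differ by a null family, on which the uniformly bounded [phi i] tend to
    0. *)
Lemma ultra_functional_upi (x : linfty I V) :
  ultra_functional (upi x) = lim (toR (phi i (x i)) @[i --> U]).
Proof.
rewrite /ultra_functional; set y := urepr _.
have [M yM] := ultra_functional_bound y; have [N xN] := ultra_functional_bound x.
have [P zP] := ultra_functional_bound (y - x).
have yE : (fun i => toR (phi i (y i))) =
    (fun i => 1 * toR (phi i ((y - x) i)) + toR (phi i (x i))).
  by apply/funext => i; rewrite mul1r -toRD -linearD /= subrK.
rewrite yE (ultra_limP _ zP xN) mul1r -[RHS]add0r; congr (_ + _).
apply/cvg_lim; first exact: Rhausdorff.
have /upiP yx := @ureprK R k I U UU V (upi x); apply/norm_cvg0P.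
apply: (@squeeze_cvgr _ _ _ _ (fun=> 0) (fun i => L * rnorm (y i - x i))).
- by apply: nearW => i; rewrite normr_ge0 phi_le.
- exact: cvg_cst.
- by rewrite -(mulr0 L); exact: cvgMr.
Qed.

Lemma ultra_functional_rlin : rlin ultra_functional.
Proof.
move=> r u v; rewrite -[u in LHS]ureprK -[v in LHS]ureprK -upiZ -upiD.
have [M uM] := ultra_functional_bound (urepr u).
have [N vN] := ultra_functional_bound (urepr v).
rewrite ultra_functional_upi /ultra_functional -(ultra_limP _ uM vN).
set f := fun i => _; set g := fun i => _; suff -> : f = g by [].
by apply/funext => i; rewrite /f /g -(rlin_toR (phi i)).
Qed.

Lemma ultra_functional_le v : ultra_functional v <= L * rnorm v.
Proof.
rewrite -(ureprK v) ultra_functional_upi rnorm_upi.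
have [M vM] := ultra_functional_bound (urepr v).
apply: (@ler_cvg_ultra R I U UU (fun i => toR (phi i (urepr v i)))
  (fun i => L * rnorm (urepr v i))).
- exact: ultra_cvg vM.
- by apply: cvgMr; exact: linfty_cvg.
- by move=> i; exact: le_trans (ler_norm _) (phi_le _ _).
Qed.

Lemma ultra_dual : exists lambda : dual (ultrapower U V),
  forall v, toR (lambda v) = ultra_functional v.
Proof. exact: rlin_lift ultra_functional_rlin ultra_functional_le. Qed.

End UltraFunctionals.

(** * Order patterns in super-reflexive spaces *)

Section OrderPatterns.
Variables (R : realType) (k : scalar_kind).
Local Notation K := (scalars R k).
Variable E : normedModType K.

(** A finite piece of the double sequences that violate Grothendieck's double limit criterion. *)
Definition order_pattern (N : nat) (L eps : R) : Prop :=
  exists (y : nat -> E) (g : nat -> dual E),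
  [/\ forall n, rnorm (y n) <= L, forall m, opnorm (g m) <= L &
    forall m n m' n', (m <= n < N)%N -> (n' < m' < N)%N ->
      toR (g m' (y n')) + eps <= toR (g m (y n))].

(** Patterns of all lengths are glued along a free ultrafilter into infinite sequences [Y] in an
    ultrapower and [G] in its dual. By reflexivity the ultrafilter limit of [Y] in the bidual is a
    point [x]; with the limit [Ginf] of [G], iterated limits in the order relation contradict each
    other. *)
Lemma super_reflexive_order_pattern (L eps : R) :
  super_reflexive E -> 0 < eps -> ~ forall N, order_pattern N L eps.
Proof.
move=> Erefl eps0 /choice[y /choice[g yg]].
(* [V] refines the filter at infinity, so fixed indices lie below the length [N] for [V]-almost all
   [N]. *)
have [V [VU Vinf]] := @ultraFilterLemma nat \oo _.
have near_ge n : \forall N \near V, (n <= N)%N.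
  by apply: Vinf; exact: nbhs_infty_ge.
pose F : normedModType K := @ultrapower R k nat V VU E.
have L0 : 0 <= L.
  by have [yL _ _] := yg 0%N; exact: le_trans (rnorm_ge0 _) (yL 0%N).
have yL N n : rnorm (y N n) <= L by have [] := yg N.
have gL N m : opnorm (g N m) <= L by have [] := yg N.
have yb n : (fun N => y N n) \in @bounded_family R k nat E.
  by apply/asboolP; exists L.
pose Y n : F := @upi R k nat V VU E (Linfty (yb n)).
have YL n : rnorm (Y n) <= L.
  rewrite rnorm_upi; apply: (@ultra_lim_le _ _ V _ _ L).
    by move=> N /=; rewrite ger0_norm ?rnorm_ge0.
  by apply: nearW => N /=.
have /choice[G GE] m : exists lambda : dual F,
    forall v, toR (lambda v) = ultra_functional (fun N => g N m) v.
  exact: ultra_dual (fun N => gL N m).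
have GL m v : toR (G m v) <= L * rnorm v.
  by rewrite GE; exact: ultra_functional_le.
have GL' m v : `|toR (G m v)| <= L * rnorm v.
  by rewrite ler_norml GL andbT lerNl -toRN -linearN -(rnormN v) GL.
have GY m n : toR (G m (Y n)) = lim (toR (g N m (y N n)) @[N --> V]).
  by rewrite GE (ultra_functional_upi (fun N => gL N m)).
have order m n m' n' : (m <= n)%N -> (n' < m')%N ->
    toR (G m' (Y n')) + eps <= toR (G m (Y n)).
  move=> mn mn'; rewrite !GY.
  have b p q N : `|toR (g N p (y N q))| <= L * L.
    rewrite (le_trans (normr_toR _))// (le_trans (opnorm_le _ _))//.
    by rewrite ler_pM ?opnorm_ge0 ?rnorm_ge0.
  have limE := ultra_limP (-1) (b m' n') (b m n).
  rewrite addrC -lerBrDr addrC -mulN1r -limE.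
  have bd N : `|-1 * toR (g N m' (y N n')) + toR (g N m (y N n))| <= L * L + L * L.
    by rewrite (le_trans (ler_normD _ _))// mulN1r normrN lerD.
  apply: (ultra_lim_ge bd); near=> N; have [_ _ ord] := yg N.
  rewrite mulN1r addrC lerBrDr addrC; apply: ord.
    by rewrite mn; near: N; exact: near_ge.
  by rewrite mn'; near: N; exact: near_ge.
have [Ginf GinfE] : exists lambda : dual F, forall v,
    toR (lambda v) = lim (toR (G m v) @[m --> V]).
  apply: (@rlin_lift R k F (fun v => lim (toR (G m v) @[m --> V])) L).
    move=> r u v; rewrite -(ultra_limP r (fun m => GL' m u) (fun m => GL' m v)).
    set f := (fun m : nat => _); set h := (fun m : nat => _).
    suff -> : f = h by [].
    by apply/funext => m; rewrite /f /h (rlin_toR (G m)).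
  move=> v; apply: ultra_lim_le; first exact: (fun m => GL' m v).
  by apply: nearW => m; exact: GL.
have evL n (mu : dual F) : `|toR (mu (Y n))| <= L * rnorm mu.
  rewrite (le_trans (normr_toR _))// (le_trans (opnorm_le _ _))//.
  by rewrite mulrC rnorm_bopE ler_wpM2r ?opnorm_ge0.
have [Phi PhiE] : exists Phi : bidual F, forall mu : dual F,
    toR (Phi mu) = lim (toR (mu (Y n)) @[n --> V]).
  apply: (@rlin_lift R k (dual F)
    (fun mu : dual F => lim (toR (mu (Y n)) @[n --> V])) L).
    move=> r u v; rewrite -(ultra_limP r (fun n => evL n u) (fun n => evL n v)).
    set f := (fun m : nat => _); set h := (fun m : nat => _).
    suff -> : f = h by [].
    by apply/funext => m; rewrite /f /h -toRM -toRD.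
  move=> mu; apply: ultra_lim_le; first exact: (fun n => evL n mu).
  by apply: nearW => n; exact: le_trans (ler_norm _) (evL n mu).
have [x xPhi] := Erefl nat V VU Phi.
have xE (mu : dual F) : toR (mu x) = lim (toR (mu (Y n)) @[n --> V]).
  by rewrite -PhiE -xPhi.
(* Limits are taken in [order]: [m'] and [n] here, then [n'], finally [m], which leaves
   [Ginf x + eps <= Ginf x]. *)
have h1 m n' : toR (Ginf (Y n')) + eps <= toR (G m x).
  rewrite [leRHS]xE; apply: (ultra_lim_ge (fun n => evL n (G m))).
  near=> n; rewrite GinfE -lerBrDr.
  apply: (ultra_lim_le (fun m => GL' m (Y n'))); near=> m'.
  rewrite lerBrDr; apply: order; first by near: n; exact: near_ge.
  by near: m'; exact: near_ge.
have h2 m : toR (Ginf x) + eps <= toR (G m x).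
  rewrite [toR (Ginf x)]xE -lerBrDr; apply: (ultra_lim_le (fun n => evL n Ginf)).
  by apply: nearW => n; rewrite lerBrDr.
have : toR (Ginf x) + eps <= toR (Ginf x).
  rewrite [leRHS]GinfE; apply: (ultra_lim_ge (fun m => GL' m x)).
  exact: nearW.
by rewrite leNgt ltrDl eps0.
Unshelve. all: by end_near.
Qed.

End OrderPatterns.

(** * Ultrapowers of operator algebras *)

Section IsomorphismBounds.
Variables (R : realType) (k : scalar_kind).
Local Notation K := (scalars R k).

(** Rescale [x] so that [v x] has norm 1. Having two maps covers both [f] and its inverse on the
    image, by taking [u] or [v] to be the identity. *)
Lemma linear_dominated (X Y Z : normedModType K) (u : X -> Y) (v : X -> Z) (e : K) :
  linear u -> linear v -> 0 < e -> (forall x, `|u x| < e -> `|v x| < 1) ->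
  exists2 M : R, 0 <= M & forall x, rnorm (v x) <= M * rnorm (u x).
Proof.
move=> ul vl e0 uv; pose e' := toR e.
have eE : ofR k e' = e by rewrite toRK// ltW.
have ltr_ofR : {mono @ofR R k : x y / x < y} by exact/leW_mono/ler_ofR.
have e'0 : 0 < e' by rewrite -ltr_ofR eE ofR0.
have lZ (W : normedModType K) (w : X -> W) (r : R) x : linear w -> 0 <= r ->
    rnorm (w (ofR k r *: x)) = r * rnorm (w x).
  move=> wl r0; have w0 : w 0 = 0.
    by have := wl (-1) 0 0; rewrite scaler0 addr0 scaleN1r addNr.
  by have := wl (ofR k r) x 0; rewrite w0 !addr0 => ->; rewrite rnormZ rnorm_ofR.
exists (2 / e') => [|x]; first by rewrite divr_ge0// ltW.
rewrite leNgt; apply/negP => lt.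
have v0 : 0 < rnorm (v x).
  by apply: le_lt_trans lt; rewrite mulr_ge0 ?rnorm_ge0// divr_ge0// ltW.
have r0 : 0 <= (rnorm (v x))^-1 by rewrite invr_ge0 ltW.
have := uv (ofR k (rnorm (v x))^-1 *: x).
rewrite -!rnormE !lZ// -(ofR1 R k) -eE !ltr_ofR mulVf ?gt_eqF// ltxx.
suff -> : (rnorm (v x))^-1 * rnorm (u x) < e' by move=> /(_ isT).
rewrite mulrC ltr_pdivrMr//.
move: lt; rewrite mulrAC ltr_pdivrMr//.
have := rnorm_ge0 (u x); have := mulr_gt0 v0 e'0; lra.
Qed.

Lemma algebra_iso_bounds (A B : normedAlgType K) (S : set B) (f : A -> B) :
  algebra_iso_onto S f -> exists2 M : R, 0 <= M &
  (forall a, rnorm (f a) <= M * rnorm a) /\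
  (forall a, rnorm a <= M * rnorm (f a)).
Proof.
move=> [fl _ fS fc [g fg gc]].
have f0 : f 0 = 0 by have := fl (-1) 0 0; rewrite scaler0 addr0 scaleN1r addNr.
have g0 : g 0 = 0 by have := fg 0; rewrite f0.
have S0 : S (f 0) by have [h _ _] := fS; exact: h.
have [e1 e10 fe] : exists2 e : K, 0 < e & forall x, `|x| < e -> `|f x| < 1.
  have fcvg : f x @[x --> (0 : A)] --> f 0 by exact: fc.
  move/cvgrPdist_lt : fcvg => /(_ _ ltr01)/nbhs_norm0P[e e0 he].
  by exists e => // x /he /=; rewrite f0 sub0r normrN.
(* Continuity of the inverse within [S] at [f 0 = 0], restated on [A]. *)
have [e2 e20 ge] : exists2 e : K, 0 < e & forall x, `|f x| < e -> `|x| < 1.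
  move/subspace_continuousP : gc => /(_ _ S0).
  rewrite f0 => gS; move/cvgrPdist_lt : gS => /(_ _ ltr01)/nbhs_norm0P[e e0 he].
  exists e => // x /he /=; rewrite /from_subspace g0 fg sub0r normrN; apply.
  by have [h _ _] := fS; exact: h.
have [M M0 fM] := linear_dominated (u := id) (fun _ _ _ => erefl) fl e10 fe.
have [N N0 gN] := linear_dominated (v := id) fl (fun _ _ _ => erefl) e20 ge.
exists (M + N); first exact: addr_ge0.
split=> a; rewrite mulrDl.
  by rewrite (le_trans (fM a))// lerDl mulr_ge0// rnorm_ge0.
by rewrite (le_trans (gN a))// lerDr mulr_ge0// rnorm_ge0.
Qed.

End IsomorphismBounds.

(** * Matrix coefficients and their ultraproducts *)

Section OperatorUltrapower.
Variables (R : realType) (k : scalar_kind).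
Local Notation K := (scalars R k).
Variables (A : normedAlgType K) (E : normedModType K) (f : A -> bop E E) (M : R).
Hypotheses (f_linear : linear f) (f_mul : {morph f : a b / amul a b}).
Hypotheses (M0 : 0 <= M) (f_le : forall a, rnorm (f a) <= M * rnorm a)
  (f_ge : forall a, rnorm a <= M * rnorm (f a)).

Lemma coefficient_bounded_linear (g : dual E) (x : E) :
  (fun a => g (f a x)) \in @bounded_linear R k A K^o.
Proof.
apply/asboolP; split=> [c a b|]; first by rewrite f_linear /= linearP.
exists (opnorm g * M * rnorm x) => a; rewrite (le_trans (opnorm_le _ _))//.
rewrite -!mulrA ler_wpM2l ?opnorm_ge0// (le_trans (opnorm_le _ _))//.
by rewrite mulrCA [leLHS]mulrC ler_wpM2l ?rnorm_ge0// -rnorm_bopE.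
Qed.

Definition coefficient (g : dual E) (x : E) : dual A :=
  Bop (coefficient_bounded_linear g x).

(** This is where operators matter: the coefficient of a product is a functional depending only on
    [a], applied to a vector depending only on [b]. *)
Lemma coefficient_mul g x a b :
  coefficient g x (amul a b) = bop_comp g (f a) (f b x).
Proof. by rewrite /= f_mul. Qed.

Lemma opnorm_coefficient g x : opnorm g <= 1 -> rnorm x <= 1 ->
  opnorm (coefficient g x) <= M.
Proof.
move=> g1 x1; rewrite opnorm_lub// => a /=; rewrite (le_trans (opnorm_le _ _))//.
rewrite (@le_trans _ _ (1 * rnorm (f a x)))// ?ler_wpM2r ?rnorm_ge0// mul1r.
apply: (le_trans (opnorm_le _ _)); rewrite -rnorm_bopE.
by rewrite -[leRHS]mulr1 ler_pM ?rnorm_ge0.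
Qed.

(** [x] nearly attains the norm of [f a], and [g] norms [f a x]. The error [e / (M + 1)] stays below
    [e] after multiplication by [M], also when [M = 0]. *)
Lemma coefficient_norming (a : A) (e : R) : 0 < e -> exists (g : dual E) (x : E),
  [/\ opnorm g <= 1, rnorm x <= 1 & rnorm a <= M * toR (coefficient g x a) + e].
Proof.
move=> e0; have M1 : 0 < M + 1 by rewrite ltr_wpDl.
have eM : 0 < e / (M + 1) by rewrite divr_gt0.
have [_ [x x1 <-] xe] := sup_adherent eM (opnorm_has_sup (f a)).
have [g g1 gx] := norming_functional (f a x).
exists g, x; split=> //; apply: (le_trans (f_ge a)); rewrite rnorm_bopE.
have fx : opnorm (f a) <= toR (coefficient g x a) + e / (M + 1).
  by rewrite -lerBlDr (le_trans (ltW xe)).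
apply: (le_trans (ler_wpM2l M0 fx)); rewrite mulrDr lerD2l.
by rewrite mulrCA ler_piMr ?(ltW e0)// ler_pdivrMr// mul1r lerDl.
Qed.

Section Fixed.
Variables (I : Type) (U : set_system I).
Context {UU : UltraFilter U}.
Local Notation C := (ultrapower U A).

Definition test_family : Type :=
  {w : I -> dual E * E | forall i, opnorm (w i).1 <= 1 /\ rnorm (w i).2 <= 1}.

Definition test_functional (w : test_family) (i : I) : dual A :=
  coefficient (sval w i).1 (sval w i).2.

Lemma opnorm_test_functional w i : opnorm (test_functional w i) <= M.
Proof. by have [g1 x1] := svalP w i; exact: opnorm_coefficient. Qed.

Lemma test_value_norm (w : test_family) (c : C) :
  `|ultra_functional (test_functional w) c| <= M * rnorm c.
Proof.
have le := ultra_functional_le (opnorm_test_functional w).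
rewrite ler_norml le andbT lerNl -(rnormN c).
by rewrite -(rlinN (ultra_functional_rlin (opnorm_test_functional w))) le.
Qed.

Lemma test_value_bounded (c : C) :
  (fun w => ultra_functional (test_functional w) c) \in @bounded_fun R test_family.
Proof. by apply/asboolP; exists (M * rnorm c) => w; exact: test_value_norm. Qed.

Definition test_value (c : C) : bfun R test_family := BFun (test_value_bounded c).

Lemma test_value_linear r (c d : C) :
  test_value (ofR k r *: c + d) = r *: test_value c + test_value d.
Proof.
apply: bfunP => w /=.
by rewrite (ultra_functional_rlin (opnorm_test_functional w)).
Qed.

(** Pairs that norm the components of a representative of [c] up to the same [e] form a single test
    family. *)
Lemma test_value_norming (c : C) (t : R) :
  (forall w, test_value c w <= t) -> rnorm c <= M * t.
Proof.
move=> ct; apply/ler_addgt0Pr => e e0.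
have /choice[w we] i : exists w : dual E * E, [/\ opnorm w.1 <= 1, rnorm w.2 <= 1 &
    rnorm (urepr c i) <= M * toR (coefficient w.1 w.2 (urepr c i)) + e].
  by have [g [x h]] := coefficient_norming (urepr c i) e0; exists (g, x).
have wb i : opnorm (w i).1 <= 1 /\ rnorm (w i).2 <= 1 by have [] := we i.
pose W : test_family := exist _ w wb.
apply: (@le_trans _ _ (M * test_value c W + e)); last first.
  by rewrite lerD2r ler_wpM2l.
have [N cN] := ultra_functional_bound (opnorm_test_functional W) (urepr c).
rewrite -[in leLHS](@ureprK _ _ _ U _ _ c) rnorm_upi.
apply: (@ler_cvg_ultra R I U UU (fun i => rnorm (urepr c i))
  (fun i => M * toR (test_functional W i (urepr c i)) + e)).
- exact: linfty_cvg.
- apply: cvgD; last exact: cvg_cst.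
  by apply: cvgMr; exact: ultra_cvg cN.
- by move=> i; have [] := we i.
Qed.

(** Finitely many conditions hold at a common index [i]; there [coefficient_mul] splits the values
    into functionals [g o f (a m)] and vectors [f (b n) x]. Two errors of [eps / 4] leave [eps / 2],
    and [L + 1] allows for representatives whose norms are only near their limit. *)
Lemma test_value_order_pattern (N : nat) (L eps : R) (w : test_family)
    (a b : nat -> C) : 0 < eps ->
  (forall n, rnorm (a n) <= L) -> (forall n, rnorm (b n) <= L) ->
  (forall m n m' n', (m <= n < N)%N -> (n' < m' < N)%N ->
     test_value (amul (a m') (b n')) w + eps <=
     test_value (amul (a m) (b n)) w) ->
  order_pattern E N (M * (L + 1)) (eps / 2).
Proof.
move=> eps0 aL bL ord.
have L0 : 0 <= L by exact: le_trans (rnorm_ge0 _) (aL 0%N).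
pose phi := test_functional w.
pose v m n i : R := toR (phi i (amul (urepr (a m) i) (urepr (b n) i))).
have vE m n : test_value (amul (a m) (b n)) w = lim (v m n i @[i --> U]).
  exact: (ultra_functional_upi (opnorm_test_functional w)
    (linfty_mul (urepr (a m)) (urepr (b n)))).
have near_norm (c : C) : rnorm c <= L ->
    \forall i \near U, rnorm (urepr c i) <= L + 1.
  move=> cL; have cc : rnorm (urepr c i) @[i --> U] --> rnorm c.
    by rewrite -[in rnorm c](@ureprK _ _ _ U _ _ c) rnorm_upi; exact: linfty_cvg.
  have cL1 : rnorm c < L + 1 by rewrite (le_lt_trans cL)// ltrDl.
  by apply: filterS (cvgr_lt _ cc _ cL1) => i /ltW.
have near_v m n : \forall i \near U,
    `|test_value (amul (a m) (b n)) w - v m n i| < eps / 4.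
  have [B vB] := ultra_functional_bound (opnorm_test_functional w)
    (linfty_mul (urepr (a m)) (urepr (b n))).
  have vc : v m n i @[i --> U] --> test_value (amul (a m) (b n)) w.
    by rewrite vE; exact: ultra_cvg vB.
  by move/cvgrPdist_lt : vc; apply; rewrite divr_gt0.
have na : \forall i \near U, forall n : 'I_N, rnorm (urepr (a n) i) <= L + 1.
  by apply: filter_forall => n; exact: near_norm.
have nb : \forall i \near U, forall n : 'I_N, rnorm (urepr (b n) i) <= L + 1.
  by apply: filter_forall => n; exact: near_norm.
have nv : \forall i \near U, forall p : 'I_N * 'I_N,
    `|test_value (amul (a p.1) (b p.2)) w - v p.1 p.2 i| < eps / 4.
  by apply: filter_forall => p; exact: near_v.
have [i [ai [bi vi]]] := filter_ex (filterI na (filterI nb nv)).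
have [g1 x1] := svalP w i.
set g := (sval w i).1 in g1; set x := (sval w i).2 in x1.
(* The norms at [i] are controlled only for indices below [N]; the value 0 serves for the others. *)
exists (fun n => if (n < N)%N then f (urepr (b n) i) x else 0).
exists (fun m => if (m < N)%N then bop_comp g (f (urepr (a m) i)) else 0).
have ML : 0 <= M * (L + 1) by rewrite mulr_ge0// addr_ge0.
split=> [n|m|m n m' n' mn mn'].
- case: ifP => nN; last by rewrite rnorm0.
  apply: (le_trans (opnorm_le _ _)); rewrite -[leRHS]mulr1 -rnorm_bopE.
  rewrite ler_pM ?rnorm_ge0// (le_trans (f_le _))// ler_wpM2l//.
  exact: (bi (Ordinal nN)).
- case: ifP => mN; last by rewrite -rnorm_bopE rnorm0.
  apply: opnorm_lub => // y /=; apply: (le_trans (opnorm_le _ _)).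
  rewrite (@le_trans _ _ (1 * rnorm (f (urepr (a m) i) y)))//.
    by rewrite ler_wpM2r ?rnorm_ge0.
  rewrite mul1r (le_trans (opnorm_le _ _))// ler_wpM2r ?rnorm_ge0// -rnorm_bopE.
  by rewrite (le_trans (f_le _))// ler_wpM2l//; exact: (ai (Ordinal mN)).
- have /andP[mn1 nN] := mn; have mN := leq_ltn_trans mn1 nN.
  have /andP[mn1' mN'] := mn'; have nN' := ltn_trans mn1' mN'.
  rewrite nN nN' mN mN'.
  have := vi (Ordinal mN, Ordinal nN); have := vi (Ordinal mN', Ordinal nN').
  have vi_eq p q :
      toR (bop_comp g (f (urepr (a p) i)) (f (urepr (b q) i) x)) = v p q i.
    by rewrite /v coefficient_mul.
  rewrite !vi_eq; have := ord _ _ _ _ mn mn' => /=.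
  by move=> h /ltr_normlP[h1 h2] /ltr_normlP[h3 h4]; lra.
Qed.

End Fixed.
End OperatorUltrapower.

(** * Comparison of the two Arens products *)

Section ArensRegularity.
Variables (R : realType) (k : scalar_kind).
Local Notation K := (scalars R k).
Variables (A : normedAlgType K) (E : normedModType K) (f : A -> bop E E) (M : R).
Hypotheses (f_linear : linear f) (f_mul : {morph f : a b / amul a b}).
Hypotheses (M0 : 0 <= M) (f_le : forall a, rnorm (f a) <= M * rnorm a)
  (f_ge : forall a, rnorm a <= M * rnorm (f a)).
Variables (I : Type) (U : set_system I).
Context {UU : UltraFilter U}.
Local Notation C := (@ultrapower R k I U UU A).

Lemma arens1_le_arens2 (Phi Psi : bidual C) (mu : dual C) : super_reflexive E ->
  toR (arens1 Phi Psi mu) <= toR (arens2 Phi Psi mu).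
Proof.
move=> Erefl; rewrite leNgt; apply/negP => lt.
pose h (c : C) : bfun R (test_family E I) := test_value f_linear M0 f_le c.
pose N0 := opnorm mu * M.
have N00 : 0 <= N0 by rewrite mulr_ge0// opnorm_ge0.
have w0P : forall i : I, opnorm (0 : dual E) <= 1 /\ rnorm (0 : E) <= 1.
  by move=> _; rewrite -rnorm_bopE !rnorm0.
(* A point of the domain of the test functions, as [mean_extension] requires. *)
pose w0 : test_family E I := exist _ (fun=> (0, 0)) w0P.
have h_norming (c : C) (t : R) : (forall w, h c w <= t) -> toR (mu c) <= N0 * t.
  move=> ct; rewrite (le_trans (toR_le_rnorm _))// (le_trans (opnorm_le _ _))//.
  by rewrite -mulrA ler_wpM2l ?opnorm_ge0//; exact: (test_value_norming f_ge ct).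
have hl r (c d : C) : h (ofR k r *: c + d) = r *: h c + h d.
  exact: test_value_linear.
have [nu nuN nuE] := mean_extension w0 N00 hl (rlin_toR mu) h_norming.
have Bpsd := mean_form_psd nuN.
pose hh (a b : C) := h (amul a b).
have hhb : rbilinear hh.
  split=> [r a a' b|r a b b']; rewrite /hh -hl.
    by rewrite amulDl amulZl.
  by rewrite amulDr amulZr.
pose L0 := Num.sqrt N0 * M.
have L00 : 0 <= L0 by rewrite mulr_ge0// sqrtr_ge0.
have hhL : form_bounded2 (mean_form nu) hh L0.
  move=> a b; rewrite -!mulrA; apply: (mean_form_norm nuN N00) => [|w].
    by rewrite !mulr_ge0 ?rnorm_ge0.
  rewrite (le_trans (test_value_norm f_linear M0 f_le w _))//.
  by rewrite ler_wpM2l// rnorm_amul.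
pose g := toR (arens1 Phi Psi mu) - toR (arens2 Phi Psi mu).
have g0 : 0 < g by rewrite subr_gt0.
pose L := opnorm Phi + opnorm Psi + 1.
have L_gt0 : 0 < L by rewrite ltr_wpDl ?addr_ge0 ?opnorm_ge0.
have PhiL : opnorm Phi <= L by rewrite /L -addrA lerDl addr_ge0 ?opnorm_ge0.
have PsiL : opnorm Psi <= L.
  by rewrite /L (addrC (opnorm Phi)) -addrA lerDl addr_ge0 ?opnorm_ge0.
pose P w := bidual_real Phi (fun a =>
  bidual_real Psi (fun b => mean_form nu (hh a b) w)).
pose Q w := bidual_real Psi (fun b =>
  bidual_real Phi (fun a => mean_form nu (hh a b) w)).
have form1 a b :
    mean_form nu (hh a b) (bcst (test_family E I) 1) = toR (mu (amul a b)).
  by rewrite -nuE; congr nu; apply: bfunP => w /=; rewrite mulr1.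
(* Since [nu (h c)] is the real part of [mu c], evaluating [P] and [Q] at the constant 1 gives the
   real parts of the two Arens products at [mu]. *)
have P1 : P (bcst _ 1) = toR (arens1 Phi Psi mu).
  rewrite -[RHS](bidual_real_toR Phi (bidual_lact Psi mu)).
  congr bidual_real; apply/funext => a.
  rewrite -[RHS](bidual_real_toR Psi (dual_ract mu a)).
  by congr bidual_real; apply/funext => b; rewrite form1.
have Q1 : Q (bcst _ 1) = toR (arens2 Phi Psi mu).
  rewrite -[RHS](bidual_real_toR Psi (bidual_ract mu Phi)).
  congr bidual_real; apply/funext => b.
  rewrite -[RHS](bidual_real_toR Phi (dual_lact b mu)).
  by congr bidual_real; apply/funext => a; rewrite form1.
have H0 : 0 <= M * (L * L) by rewrite !mulr_ge0// ltW.
have eps0 : 0 < g / (8 * (N0 + 1)) by rewrite divr_gt0// mulr_gt0// ltr_wpDl.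
have eps20 : 0 < g / (8 * (N0 + 1)) / 2 by rewrite divr_gt0.
(* The gap [g] and the mass [N0] fix the separation before the length [N] is chosen; only [delta]
   and the sequences depend on [N]. *)
apply: (super_reflexive_order_pattern (L := M * (L + 1)) Erefl eps20) => N.
have [delta delta0 pat] := mean_order_pattern nuN N00 N H0 g0.
have [a [b [aL bL abP abQ]]] := double_limit_sequences Bpsd N.+2 L00 hhb hhL
  PhiL PsiL L_gt0 delta0.
have [||w ww] := pat (fun m n => hh (a m) (b n)) P Q _ _ abP abQ.
- move=> m n w; rewrite (le_trans (test_value_norm f_linear M0 f_le w _))//.
  by rewrite ler_wpM2l// (le_trans (rnorm_amul _ _))// ler_pM ?rnorm_ge0.
- by rewrite P1 Q1.
apply: (test_value_order_pattern f_mul (w := w) eps0 aL bL).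
move=> m n m' n' /andP[mn nN] /andP[mn' mN']; apply: ww.
  by rewrite mn (ltn_trans nN).
by rewrite mn' (ltn_trans mN').
Qed.

(** The inequality for [- mu] is the reverse inequality for [mu], and real parts determine a
    functional. *)
Lemma ultrapower_arens_regular : super_reflexive E -> arens_regular C.
Proof.
move=> Erefl Phi Psi; apply: dual_eq_toR => mu; apply/eqP; rewrite eq_le.
rewrite arens1_le_arens2//=.
have oppE (Theta : bidual C) : toR (Theta (- mu)) = - toR (Theta mu).
  by rewrite linearN toRN.
by have := arens1_le_arens2 Phi Psi (- mu) Erefl; rewrite !oppE lerN2.
Qed.

End ArensRegularity.

Theorem proposition3p1 (R : realType) (k : scalar_kind)
    (A : banachAlgType (scalars R k))
    (E : completeNormedModType (scalars R k)) :
  super_reflexive E ->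
  forall S : set (bop E E), closed_subalgebra S ->
  (exists f : A -> bop E E, algebra_iso_onto S f) ->
  super_arens_regular A.
Proof.
move=> Erefl S _ [f fiso] I U UU.
have [M M0 [f_le f_ge]] := algebra_iso_bounds fiso.
have [fl fm _ _ _] := fiso.
exact: (ultrapower_arens_regular fl fm M0 f_le f_ge Erefl).
Qed.
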